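(* Let $(\Sigma_P,\theta,\mu)$ be a Markov shift over a finite alphabet. Let $x=(x_1,x_2,\dots)\in\Sigma_P$ be a periodic point of prime period $p$ such that $(x_1,\dots,x_p)$ is a reduced word and the local escape rate $\rho(x,\mathbbm{1})$ exists. Let $\varphi$ be a ceiling function with values in $\mathbb{N}$ which is constant on $n$-cylinders, where $n$ is a positive multiple of $p$. For $\nu\in\mathbb{N}$ let $A_\nu=[x_1,\dots,x_{\nu p}]$, $\mu_\nu=\mu(A_\nu)$, and for $\nu>n/p$ let $s_1(\nu),\dots,s_k(\nu)$ (for fixed $k\in\mathbb{N}$) be as defined in the context, and $z_\nu=e^{\rho(A_\nu,\varphi)}$. Then, as $\nu\to\infty$, \[\big|z_\nu-(1+s_1\mu_\nu+s_2\mu_\nu^2+\dots+s_k\mu_\nu^k)\big|=o(\mu_\nu^k).\]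
   Context: Markov shift: $P=(p_{a,b})$ non-negative irreducible row-stochastic on finite $S$, $\Sigma_P=\{x\in S^{\mathbb{N}}:p_{x_i,x_{i+1}}>0\}$, $\theta$ the shift, $\pi$ the positive stationary probability vector, $\mu([a_1,\dots,a_n])=\pi_{a_1}\prod_{i<n}p_{a_i,a_{i+1}}$; metric $d(x,y)=e^{-\beta|x\wedge y|}$ ($\beta>0$, $|x\wedge y|$ the length of the common prefix). A word $(a_1,\dots,a_m)$ is reduced if there is $a_m'\ne a_m$ with $(a_1,\dots,a_{m-1},a_m')$ admissible. Ceiling function/special flow/escape rate: for $\varphi$ with $\inf\varphi>0$, $S_j\varphi=\sum_{i<j}\varphi\circ\theta^i$, $N_t(y)=\min\{j\ge0:S_j\varphi(y)>t\}$, $\overline{X}=\{(y,s):0\le s<\varphi(y)\}$ with $\overline{\mu}$ the restriction of $\mu\otimes$Lebesgue, $\Phi_t(y,s)=(y,s+t)$ if $t<\varphi(y)-s$, else $(\theta^{N-1}y,s+t-S_{N-1}\varphi(y))$, $N=N_{s+t}(y)$; for a hole $A$ (measurable, $\bigcup\theta^{-j}A=X$ a.e.), $\rho(A,\varphi)=\lim_{t\to\infty}-\frac1t\log\overline{\mu}(\{(y,s):\forall\tau\in[0,t]:\Phi_\tau(y,s)\notin A\times\mathbb{R}\})$; local escape rate $\rho(x,\varphi)=\lim_{r\to0}\rho(B_r(x),\varphi)/\mu(B_r(x))$, $\mathbbm{1}$ the constant $1$. Matrix: with $\varphi=\sum_{C\in C_n}k_C\mathbbm{1}_C$, blocks $\overline{C}_n=\{C\times[k-1,k):C\in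 C_n,1\le k\le k_C\}$ (fixed enumeration), $\overline{M}$ is the block matrix with $\overline{M}_{C\times[k-1,k),C\times[k,k+1)}=1$ for $k<k_C$, $\overline{M}_{[a_1..a_n]\times[k_C-1,k_C),[a_2..a_n,a]\times[0,1)}=p_{a_n,a}$ ($a\in S$), all other entries $0$. $G$ is the polynomial with $\det(\mathrm{id}-z\overline{M})=(1-z)G(z)$; $t$ is the index of $[x_1,\dots,x_n]\times[0,1)$, $r$ the index of $[x_{\nu p-n+1},\dots,x_{\nu p}]\times[0,1)$, $C_{t,r}(z)=(-1)^{t+r}\det[\mathrm{id}-z\overline{M}]_{t,r}$ (row $t$, column $r$ deleted). Let $c_o=p_{x_1,x_2}\cdots p_{x_p,x_{p+1}}$, $o=S_p\varphi(x)$, $s=\nu-n/p$, $k_0=so$, $\mu_t=\mu([x_1,\dots,x_n])$, $\mu_w=\mu([x_1,\dots,x_p])$, $g_1(z)=\frac{(1-z)G(z)}{1-c_oz^o}$, $g_{2,\nu}(z)=\frac{1}{\mu_t}C_{t,r}(z)z^{k_0}-\frac{c_o^{1-n/p}}{\mu_w}\cdot\frac{(1-z)G(z)z^{os}}{1-c_oz^o}$. Then $s_1(\nu),\dots,s_k(\nu)$ are the unique reals such that, with $z(u)=1+\sum_{j=1}^ks_ju^j$, the function $u\mapsto g_1(z(u))+u\,g_{2,\nu}(z(u))$ has vanishing Taylor coefficients at $u=0$ of orders $1,\dots,k$. *)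

(* Defs.v *)
From HB Require Import structures.
From mathcomp Require Import all_boot all_order all_algebra.
From mathcomp Require Import all_classical all_reals all_analysis.
Set Implicit Arguments.
Unset Strict Implicit.
Unset Printing Implicit Defensive.
Import Order.TTheory GRing.Theory Num.Theory.
Import numFieldNormedType.Exports.
Local Open Scope classical_set_scope.
Local Open Scope ring_scope.

(* The sequence space S^N, given a pointed structure (from a letter a0) so that
   MathComp-Analysis can build a measurable space on it; the point is irrelevant. *)
Definition seqS (S : finType) (a0 : S) := nat -> S.
HB.instance Definition _ (S : finType) (a0 : S) := Choice.on (@seqS S a0).
HB.instance Definition _ (S : finType) (a0 : S) :=
  isPointed.Build (@seqS S a0) (fun _ => a0).

Section MarkovShift.
Variables (R : realType) (S : finType) (a0 : S) (P : S -> S -> R).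

Definition nonneg_mx := forall a b, 0 <= P a b.
Definition row_stochastic := forall a, \sum_(b : S) P a b = 1.
Fixpoint Ppow (m : nat) (a b : S) : R :=
  match m with
  | 0%N => (a == b)%:R
  | m'.+1 => \sum_(c : S) Ppow m' a c * P c b
  end.
Definition irreducible := forall a b, exists m : nat, 0 < Ppow m.+1 a b.
Definition stationary_prob (pi : S -> R) :=
  (forall a, 0 < pi a) /\ \sum_(a : S) pi a = 1 /\
  (forall b, \sum_(a : S) pi a * P a b = pi b).

Definition admissible_word (w : seq S) : bool :=
  all (fun ab => 0 < P ab.1 ab.2) (zip w (behead w)).
Definition reduced_word (w : seq S) : Prop :=
  (0 < size w)%N /\
  exists a' : S, a' != nth a' w (size w).-1 /\
                 admissible_word (rcons (take (size w).-1 w) a').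
Local Notation seqS := (@seqS S a0).
Local Notation sq := (nat -> S).
Definition in_SigmaP (y : sq) : Prop := forall i, 0 < P (y i) (y i.+1).
Definition cyl (w : seq S) : set sq :=
  [set y | forall i, (i < size w)%N -> y i = nth (y i) w i].
Definition cylinders : set (set seqS) := [set C | exists w, C = cyl w].
Local Notation T := (g_sigma_algebraType cylinders).

Definition markov_cyl_value (pi : S -> R) (w : seq S) : R :=
  match w with
  | [::] => 1
  | a :: _ => pi a * \prod_(ab <- zip w (behead w)) P ab.1 ab.2
  end.
Definition is_markov_measure (pi : S -> R)
  (mu : {measure set T -> \bar R}) :=
  forall w : seq S, (0 < size w)%N -> mu (cyl w) = (markov_cyl_value pi w)%:E.

Definition shiftn (j : nat) (y : sq) : sq := fun i => y (i + j)%N.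
Definition Sn (phi : sq -> nat) (y : sq) (j : nat) : nat :=
  (\sum_(i < j) phi (shiftn i y))%N.
(* length of the common prefix (only used when x <> y) *)
Definition lcp (x y : sq) : nat :=
  xget 0%N [set L | (forall i, (i < L)%N -> x i = y i) /\ x L <> y L].
Definition dist (beta : R) (x y : sq) : R :=
  if `[< x = y >] then 0 else expR (- beta * (lcp x y)%:R).
Definition ball_Sigma (beta : R) (x : sq) (r : R) : set sq :=
  [set y | in_SigmaP y /\ dist beta x y < r].

Definition Nt (phi : sq -> nat) (y : sq) (t : R) : nat :=
  xget 0%N [set j | t < (Sn phi y j)%:R /\
                    forall i, (i < j)%N -> (Sn phi y i)%:R <= t].
Definition flow (phi : sq -> nat) (t : R) (ys : sq * R) : sq * R :=
  let y := ys.1 in let s := ys.2 in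
  if t < (phi y)%:R - s then (y, s + t)
  else let N := Nt phi y (s + t) in
       (shiftn N.-1 y, s + t - (Sn phi y N.-1)%:R).
Definition survivors (phi : sq -> nat) (A : set sq) (t : R) : set (T * R) :=
  [set ys | 0 <= ys.2 /\ ys.2 < (phi ys.1)%:R /\
            forall tau, 0 <= tau -> tau <= t -> ~ A (flow phi tau ys).1].
Definition escape_rate (mu : {measure set T -> \bar R}) (phi : sq -> nat)
  (A : set sq) : R :=
  lim ((fun t : R => - (ln (fine ((mu \x lebesgue_measure)%E
                                     (survivors phi A t)))) / t) @ +oo).
Definition one_fun : sq -> nat := fun _ => 1%N.
Definition local_escape_rate_exists (mu : {measure set T -> \bar R})
  (beta : R) (x : sq) : Prop :=
  cvg ((fun r : R => escape_rate mu one_fun (ball_Sigma beta x r)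
                      / fine (mu (ball_Sigma beta x r))) @ 0^'+).
End MarkovShift.
Notation Tspace S a0 := (g_sigma_algebraType (@cylinders S a0)).

Section BlockMatrix.
Variables (R : realType) (S : finType) (P : S -> S -> R) (n : nat).
Variable kc : n.-tuple S -> nat.
Definition ceil_of (y : nat -> S) : nat := kc [tuple y i | i < n].

Definition Kmax : nat := (\max_(w : n.-tuple S) kc w).+1.
(* the blocks C x [j, j+1), 0 <= j < k_C, C an (admissible) n-cylinder *)
Definition blockT : predArgType :=
  {b : n.-tuple S * 'I_Kmax | admissible_word P b.1 && (b.2 < kc b.1)%N}.
Definition trans_last (w w' : seq S) : R :=
  match w, w' with
  | a :: w1, b :: w1' => P (last a w1) (last b w1')
  | _, _ => 0
  end.
Definition mbar (b b' : blockT) : R :=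
  let w := (val b).1 in let j := (val b).2 in
  let w' := (val b').1 in let j' := (val b').2 in
  if (j.+1 < kc w)%N then ((w' == w) && (nat_of_ord j' == j.+1))%:R
  else if (nat_of_ord j' == 0%N) && (behead w == take n.-1 w')
       then trans_last w w' else 0.
Definition Mbar : 'M[R]_#|blockT| :=
  \matrix_(i, j) mbar (enum_val i) (enum_val j).
Definition Apoly : 'M[{poly R}]_#|blockT| := 1%:M - 'X *: map_mx polyC Mbar.
(* det(id - z Mbar) = (1 - z) G(z) *)
Definition Gpoly : {poly R} := \det Apoly %/ (1 - 'X).
Definition blk_index (b : n.-tuple S * 'I_Kmax) : option 'I_#|blockT| :=
  omap enum_rank (insub b : option blockT).
Definition Cpoly (bt br : n.-tuple S * 'I_Kmax) : {poly R} :=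
  match blk_index bt, blk_index br with
  | Some t, Some r => cofactor Apoly t r
  | _, _ => 0
  end.
End BlockMatrix.

Section TaylorData.
Variables (R : realType) (S : finType) (a0 : S) (P : S -> S -> R).
Variable mu : {measure set (g_sigma_algebraType (@cylinders S a0)) -> \bar R}.
Variables (x : nat -> S) (p n : nat) (kc : n.-tuple S -> nat) (k : nat).

Definition c_o : R := \prod_(i < p) P (x i) (x i.+1).
Definition o_per : nat := Sn (ceil_of kc) x p.
Definition mu_t : R := fine (mu (cyl (mkseq x n))).
Definition mu_w : R := fine (mu (cyl (mkseq x p))).
Definition wt : n.-tuple S := [tuple x i | i < n].
Definition wr (nu : nat) : n.-tuple S := [tuple x (nu * p - n + i)%N | i < n].
Definition g1 (z : R) : R :=
  (1 - z) * (Gpoly P kc).[z] / (1 - c_o * z ^+ o_per).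
Definition g2 (nu : nat) (z : R) : R :=
  let s := (nu - n %/ p)%N in
  let k0 := (s * o_per)%N in
  mu_t^-1 * (@Cpoly R S P n kc (wt, ord0) (wr nu, ord0)).[z] * z ^+ k0
  - c_o ^ (1 - (n %/ p)%:Z) / mu_w
    * ((1 - z) * (Gpoly P kc).[z] * z ^+ (o_per * s) / (1 - c_o * z ^+ o_per)).
Definition zpoly (sv : nat -> R) (u : R) : R :=
  1 + \sum_(1 <= j < k.+1) sv j * u ^+ j.
Definition taylor_fun (nu : nat) (sv : nat -> R) (u : R) : R :=
  g1 (zpoly sv u) + u * g2 nu (zpoly sv u).
Definition s_coeffs_spec (nu : nat) (sv : nat -> R) : Prop :=
  forall m : nat, (1 <= m <= k)%N -> derive1n m (taylor_fun nu sv) 0 = 0.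
End TaylorData.

(* Main.v *)
Require Import Defs.
From HB Require Import structures.
From mathcomp Require Import all_boot all_order all_algebra.
From mathcomp Require Import all_classical all_reals all_analysis.
From mathcomp Require Import measurable_realfun zify ring lra.
Import Order.TTheory GRing.Theory Num.Theory.
Import numFieldNormedType.Exports.
Set Implicit Arguments.
Unset Strict Implicit.
Unset Printing Implicit Defensive.
Local Open Scope classical_set_scope.
Local Open Scope ring_scope.

(** Write [q_w(z)] for the cofactors of [id - z Mbar] in the row of the block
    [tau x [0,1)], where [tau = [x_1..x_n]], and [K = q / q_tau]. Then [K] is
    [z]-harmonic off [tau], with defect [D = (1 - z) G(z) / q_tau(z)] at [tau], and
    is positive for [z] near [1]. Add an offset [d_l] to [K] on
    words that end with a run [x_1..x_(n+l)]. For suitable offsets, the resulting function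
    is [z]-harmonic for the shift killed at the end of a run of length [nu p] precisely when
    [y G(1+y) = mu_nu (1+y)^k0 B(y)] for [z = 1 + y], with [B] a fixed polynomial. The
    killed harmonic function is positive, since a reduced word can be left at its last
    letter, so the surviving mass at time [t] is comparable to [z^-t] and
    [z = exp(rho(A_nu, phi))].

    The numerator of [g_1(z(u)) + u g_2(z(u))] is the residual of the same equation with
    [mu_nu] replaced by [u]. The coefficients of a truncated solution are bounded in the
    weighted norm [sum |Y_i| (k0+1)^-i], uniformly in [nu]; since [k0] grows linearly in
    [nu] and [mu_nu] decays exponentially, truncation costs [O(((k0+1) mu_nu)^(k+1))],
    which is [o(mu_nu^k)]. *)

(** The exponent [k0] grows with [nu], so the implicit function theorem applied for each [nu]
    separately gives constants that depend on [nu]. The weight [1/(k0+1)] is chosen because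
    [(1 + c/(k0+1))^k0 <= e^c]: in this scale the factor [(1+Y)^k0] stays bounded.

    The root equation comes from two boundary conditions on the offsets. The value [-1] at the end
    of the run cancels [K(tau) = 1], and [d_0 = 0] lets a run start without a jump. Over one period
    the offset obeys [e -> c e - D] with [c = c_o z^o]; for [c <> 1] and [s = nu - n/p] the
    conditions are compatible exactly when [c^s (1-c) + D (1-c^s) = 0]. Since [mu_nu = mu_t c_o^s]
    and [k0 = s o], inserting [D] gives the stated equation with [B(y) = (q_tau(z) (1 - c_o z^o) + y
    G(z)) / mu_t].

    For the root to be positive, [G(1)] and [q_tau(1)] must have the same sign. This follows from a
    minimum principle for [z > 1]: the defect at [tau] must compensate the growth factor [z]
    everywhere else. *)

(** * Weighted coefficient norms modulo a power of X *)

Section TruncatedNorm.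
Variable R : realType.
Implicit Types (A B Y : {poly R}) (rho c : R).

(** For [rho > 0] a norm on polynomials modulo ['X^J]. Truncating lets bounds on low coefficients be
    used before the higher ones are known. *)
Definition tnorm rho (J : nat) A : R := \sum_(i < J) `|A`_i| * rho ^+ i.
Definition coef_bound (A : {poly R}) c : R := \sum_(i < size A) `|A`_i| * c ^+ i.

Lemma tnorm_ge0 rho J A : 0 <= rho -> 0 <= tnorm rho J A.
Proof. by move=> r0; apply: sumr_ge0 => i _; rewrite mulr_ge0 ?exprn_ge0. Qed.

Lemma coef_bound_ge0 A c : 0 <= c -> 0 <= coef_bound A c.
Proof. by move=> r0; apply: sumr_ge0 => i _; rewrite mulr_ge0 ?exprn_ge0. Qed.

Lemma le_coef_bound A c1 c2 : 0 <= c1 -> c1 <= c2 -> coef_bound A c1 <= coef_bound A c2.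
Proof.
move=> c0 c12; apply: ler_sum => i _; rewrite ler_wpM2l //.
by rewrite lerXn2r // nnegrE ?(le_trans c0).
Qed.

Lemma eq_tnorm rho J A B : (forall i, (i < J)%N -> A`_i = B`_i) ->
  tnorm rho J A = tnorm rho J B.
Proof. by move=> AB; apply: eq_bigr => i _; rewrite AB. Qed.

Lemma tnormD rho J A B : 0 <= rho ->
  tnorm rho J (A + B) <= tnorm rho J A + tnorm rho J B.
Proof.
move=> r0; rewrite -big_split; apply: ler_sum => i _ /=.
by rewrite coefD -mulrDl ler_wpM2r ?exprn_ge0 // ler_normD.
Qed.

Lemma tnormN rho J A : tnorm rho J (- A) = tnorm rho J A.
Proof. by apply: eq_bigr => i _; rewrite coefN normrN. Qed.

Lemma tnormZ rho J c A : tnorm rho J (c *: A) = `|c| * tnorm rho J A.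
Proof. by rewrite mulr_sumr; apply: eq_bigr => i _; rewrite coefZ normrM mulrA. Qed.

Lemma le_tnorm rho J J' A : 0 <= rho -> (J <= J')%N -> tnorm rho J A <= tnorm rho J' A.
Proof.
move=> r0 JJ; rewrite /tnorm (big_ord_widen_cond J' xpredT (fun i => `|A`_i| * rho ^+ i)) //.
by rewrite [leRHS](bigID (fun i : 'I_J' => (i < J)%N)) /= lerDl; apply: sumr_ge0 => i _; rewrite mulr_ge0 ?exprn_ge0.
Qed.

(** A factor ['X] gains both a factor [rho] and one order of truncation; the bootstrap in
    [residual_bounds] lives on these two gains. *)
Lemma tnormXM rho J A : tnorm rho J.+1 ('X * A) = rho * tnorm rho J A.
Proof.
rewrite /tnorm big_ord_recl coefXM eqxx normr0 mul0r add0r mulr_sumr.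
by apply: eq_bigr => i _; rewrite coefXM /= exprS; ring.
Qed.

(** With absolute values as coefficients, both truncated norms become values at [rho] of polynomials
    [a] and [b], and [a * b] dominates the truncated product coefficientwise. *)
Lemma tnormM rho J A B : 0 <= rho ->
  tnorm rho J (A * B) <= tnorm rho J A * tnorm rho J B.
Proof.
move=> r0.
pose a := \poly_(i < J) `|A`_i|; pose b := \poly_(i < J) `|B`_i|.
have ha : tnorm rho J A = a.[rho] by rewrite horner_poly.
have hb : tnorm rho J B = b.[rho] by rewrite horner_poly.
have c0 i : 0 <= (a * b)`_i.
  by rewrite coefM sumr_ge0 // => l _; rewrite !coef_poly; do 2 case: ifP => _; rewrite ?mulr0 ?mul0r ?mulr_ge0.
rewrite ha hb -hornerM (@horner_coef_wide _ (size (a * b) + J)); last exact: leq_addr.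
apply: (@le_trans _ _ (tnorm rho J (a * b))).
  apply: ler_sum => i _; rewrite ler_wpM2r ?exprn_ge0 // [leRHS]ger0_norm // !coefM.
  apply: le_trans (ler_norm_sum _ _ _) _; apply: ler_sum => l _.
  have iJ := ltn_ord i; have li := ltn_ord l.
  have lJ : (l < J)%N by apply: leq_ltn_trans iJ; rewrite -ltnS.
  have ilJ : (i - l < J)%N by apply: leq_ltn_trans iJ; exact: leq_subr.
  by rewrite !coef_poly lJ ilJ normrM.
have -> : \sum_(i < size (a * b) + J) (a * b)`_i * rho ^+ i = tnorm rho (size (a * b) + J) (a * b).
  by apply: eq_bigr => i _; rewrite ger0_norm.
by apply: le_tnorm => //; exact: leq_addl.
Qed.

Lemma tnorm1 rho J : 0 <= rho -> tnorm rho J 1 <= 1.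
Proof.
move=> r0; case: J => [|J]; first by rewrite /tnorm big_ord0.
rewrite /tnorm big_ord_recl coef1 eqxx normr1 mul1r expr0 big1 ?addr0 // => i _.
by rewrite coef1 /= normr0 mul0r.
Qed.

Lemma tnormXn rho J A e : 0 <= rho -> tnorm rho J (A ^+ e) <= tnorm rho J A ^+ e.
Proof.
move=> r0; elim: e => [|e IH]; first by rewrite !expr0 tnorm1.
rewrite !exprS; apply: le_trans (tnormM _ _ _ r0) _.
by apply: ler_wpM2l => //; exact: tnorm_ge0.
Qed.

Lemma tnorm_comp rho J A B : 0 <= rho ->
  tnorm rho J (A \Po B) <= coef_bound A (tnorm rho J B).
Proof.
move=> r0; rewrite comp_polyE /coef_bound.
elim/big_ind2: _ => [|x u y v h1 h2|i _].
- by rewrite /tnorm big1 // => i _; rewrite coef0 normr0 mul0r.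
- exact: le_trans (tnormD _ _ _ r0) (lerD h1 h2).
- by rewrite tnormZ ler_wpM2l // tnormXn.
Qed.

(** For [i >= a] one has [mu^i <= (mu/rho)^a rho^i], so vanishing low coefficients buy a power of
    [mu/rho]. *)
Lemma horner_le_tnorm rho mu a A : 0 < rho -> 0 <= mu -> mu <= rho ->
  (forall i, (i < a)%N -> A`_i = 0) ->
  `|A.[mu]| <= (mu / rho) ^+ a * tnorm rho (size A) A.
Proof.
move=> r0 m0 mr A0; rewrite horner_coef mulr_sumr.
apply: le_trans (ler_norm_sum _ _ _) _; apply: ler_sum => i _.
case: (ltnP i a) => ia; first by rewrite A0 // mul0r normr0 mul0r mulr0.
rewrite normrM (ger0_norm (exprn_ge0 _ _)) // mulrCA ler_wpM2l //.
have -> : mu ^+ i = (mu / rho) ^+ i * rho ^+ i.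
  by rewrite -exprMn divfK // gt_eqF.
rewrite ler_wpM2r ?exprn_ge0 ?(ltW r0) //.
have q0 : 0 <= mu / rho by rewrite divr_ge0 // ltW.
by apply: ler_wiXn2l => //; rewrite ler_pdivrMr // mul1r.
Qed.

(** * Uniform bounds for truncated solutions of the root equation *)

Definition residual (A B : {poly R}) (k0 : nat) Y : {poly R} :=
  - (Y * (A \Po Y)) + 'X * ((1 + Y) ^+ k0 * (B \Po Y)).

Lemma binomial_le_expR c k0 : 0 <= c ->
  (1 + c / k0.+1%:R) ^+ k0 <= expR c.
Proof.
move=> c0; have x0 : 0 <= c / k0.+1%:R by rewrite divr_ge0.
apply: (@le_trans _ _ (expR (c / k0.+1%:R) ^+ k0)).
  by rewrite lerXn2r ?nnegrE ?expR_ge0 ?addr_ge0 // expR_ge1Dx.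
rewrite -expRM_natr ler_expR -mulrA ler_piMr // mulrC ler_pdivrMr ?ltr0n //.
by rewrite mul1r ler_nat.
Qed.

(** Write [A = A_0 + 'X * H] and solve for the linear term: [A_0 Y] equals
    ['X (1+Y)^k0 B(Y) - Y^2 H(Y)] up to the residual. Both terms gain one order, so the bound modulo
    ['X^j] yields the bound modulo ['X^(j+1)]. The constant changes at each of the [k+1] steps but
    never involves [k0]. *)
Lemma residual_bounds (A B : {poly R}) (k : nat) : A`_0 != 0 ->
  exists2 C : R, 0 < C & forall k0 Y, Y`_0 = 0 -> (size Y <= k.+1)%N ->
    (forall i, (i <= k)%N -> (residual A B k0 Y)`_i = 0) ->
    forall J, tnorm k0.+1%:R^-1 J Y <= C / k0.+1%:R /\
              tnorm k0.+1%:R^-1 J (residual A B k0 Y) <= C.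
Proof.
move=> A0.
pose H := \poly_(i < size A) A`_i.+1.
have AE : A = (A`_0)%:P + 'X * H.
  apply/polyP => -[|i]; rewrite coefD coefC coefXM /= ?addr0 // add0r coef_poly.
  case: ltnP => // h; rewrite nth_default //; exact: leq_trans h _.
have step (j : nat) : exists2 C : R, 0 <= C & forall k0 Y, Y`_0 = 0 ->
    (forall i, (i < j)%N -> (residual A B k0 Y)`_i = 0) ->
    tnorm k0.+1%:R^-1 j Y <= C / k0.+1%:R.
  elim: j => [|j [C C0 IH]].
    by exists 0 => // k0 Y _ _; rewrite /tnorm big_ord0 mul0r.
  exists (`|A`_0|^-1 * (expR C * coef_bound B C + C ^+ 2 * coef_bound H C)).
    by rewrite mulr_ge0 ?invr_ge0 // addr_ge0 // mulr_ge0 ?expR_ge0 ?exprn_ge0 ?coef_bound_ge0.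
  move=> k0 Y Y0 N0; set rho := (k0.+1%:R^-1 : R).
  have r0 : 0 < rho by rewrite invr_gt0 ltr0n.
  have r1 : rho <= 1 by rewrite invf_le1 ?ltr0n // ler1n.
  have {}IH : tnorm rho j Y <= C * rho by apply: IH => // i ij; apply: N0; exact: ltnW.
  have CrC : C * rho <= C by rewrite ler_piMr.
  have Cr0 : 0 <= C * rho by rewrite mulr_ge0 // ltW.
  have bnd D : tnorm rho j (D \Po Y) <= coef_bound D C.
    apply: le_trans (tnorm_comp _ _ _ (ltW r0)) _.
    apply: le_coef_bound; rewrite ?tnorm_ge0 ?(ltW r0) //; exact: le_trans IH CrC.
  (* Modulo ['X] only the constant coefficient of [Y] is seen, and it is 0. *)
  case: j => [|j] in N0 IH bnd *.
    rewrite /tnorm big_ord1 Y0 normr0 mul0r.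
    by rewrite !mulr_ge0 ?invr_ge0 // addr_ge0 // mulr_ge0 ?expR_ge0 ?exprn_ge0 ?coef_bound_ge0.
  have T1 : tnorm rho j.+2 ('X * ((1 + Y) ^+ k0 * (B \Po Y))) <= rho * (expR C * coef_bound B C).
    rewrite tnormXM ler_wpM2l ?(ltW r0) //.
    apply: le_trans (tnormM _ _ _ (ltW r0)) _.
    apply: ler_pM => //; rewrite ?tnorm_ge0 ?(ltW r0) //.
    apply: le_trans (tnormXn _ _ _ (ltW r0)) _; apply: le_trans (binomial_le_expR k0 C0).
    rewrite lerXn2r // ?nnegrE ?addr_ge0 ?tnorm_ge0 ?divr_ge0 ?(ltW r0) //.
    apply: le_trans (tnormD _ _ _ (ltW r0)) _; apply: lerD => //.
    by rewrite tnorm1 ?(ltW r0).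
  pose Y' := \poly_(i < size Y) Y`_i.+1.
  have YE : Y = 'X * Y'.
    apply/polyP => -[|i]; rewrite coefXM /= ?Y0 // coef_poly.
    case: ltnP => // h; rewrite nth_default //; exact: leq_trans h _.
  (* [Y] has no constant term, so two factors ['X] come out and [Y] enters only up to order [j.+1],
     where the induction hypothesis applies. *)
  have T2 : tnorm rho j.+2 (Y * (Y * (H \Po Y))) <= rho * (C ^+ 2 * coef_bound H C).
    have -> : Y * (Y * (H \Po Y)) = 'X * ('X * (Y' * (Y' * (H \Po Y)))).
      by rewrite {1 2}YE; ring.
    rewrite !tnormXM.
    have tY : rho * tnorm rho j Y' = tnorm rho j.+1 Y by rewrite -tnormXM -YE.
    have hH : tnorm rho j (H \Po Y) <= coef_bound H C.
      by apply: le_trans (bnd H); apply: le_tnorm => //; exact: ltW.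
    have y'0 : 0 <= tnorm rho j Y' by rewrite tnorm_ge0 // ltW.
    have y0 : 0 <= tnorm rho j.+1 Y by rewrite tnorm_ge0 // ltW.
    apply: (@le_trans _ _ (tnorm rho j.+1 Y ^+ 2 * coef_bound H C)).
      rewrite -tY.
      rewrite [leRHS](_ : _ = rho * (rho * (tnorm rho j Y' * (tnorm rho j Y' * coef_bound H C)))); last by ring.
      do 2 (apply: ler_wpM2l; first exact: ltW).
      apply: le_trans (tnormM _ _ _ (ltW r0)) _; apply: ler_wpM2l => //.
      by apply: le_trans (tnormM _ _ _ (ltW r0)) _; apply: ler_wpM2l.
    rewrite mulrA ler_wpM2r ?coef_bound_ge0 //.
    apply: (@le_trans _ _ ((C * rho) ^+ 2)); first by rewrite lerXn2r // nnegrE.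
    by rewrite exprMn mulrC ler_wpM2r ?exprn_ge0 // expr2 ler_piMr // ltW.
  have EQ : A`_0 *: Y = 'X * ((1 + Y) ^+ k0 * (B \Po Y)) - Y * (Y * (H \Po Y)) - residual A B k0 Y.
    rewrite /residual [in A \Po Y]AE comp_polyD comp_polyC comp_polyM comp_polyX -mul_polyC; ring.
  have : tnorm rho j.+2 (A`_0 *: Y) <= rho * (expR C * coef_bound B C) + rho * (C ^+ 2 * coef_bound H C).
    rewrite (_ : tnorm _ _ _ = tnorm rho j.+2 ('X * ((1 + Y) ^+ k0 * (B \Po Y)) - Y * (Y * (H \Po Y)))); last first.
      by apply: eq_tnorm => i ij; rewrite EQ coefB N0 // subr0.
    by apply: le_trans (tnormD _ _ _ (ltW r0)) _; rewrite tnormN lerD.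
  rewrite tnormZ -mulrDr => h.
  by rewrite -mulrA ler_pdivlMl ?normr_gt0 // [leRHS]mulrC.
have [C C0 hC] := step k.+1.
(* Order [k.+1] is enough because [Y] has degree at most [k]. The last two terms bound the two
   halves of the residual. *)
exists (1 + C + (C * coef_bound A C + expR C * coef_bound B C)).
  by rewrite ltr_wpDr ?ltr_wpDr // addr_ge0 // mulr_ge0 ?coef_bound_ge0 ?expR_ge0.
move=> k0 Y Y0 sY N0 J; set rho := (k0.+1%:R^-1 : R).
have r0 : 0 < rho by rewrite invr_gt0 ltr0n.
have r1 : rho <= 1 by rewrite invf_le1 ?ltr0n // ler1n.
have hY : tnorm rho J Y <= C * rho.
  apply: le_trans (_ : tnorm rho (k.+1 + J) Y <= _).
    by apply: le_tnorm; [exact: ltW|exact: leq_addl].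
  rewrite /tnorm big_split_ord /= [X in _ + X]big1 ?addr0; first exact: hC.
  by move=> i _; rewrite nth_default ?normr0 ?mul0r // (leq_trans sY) // leq_addr.
have CrC : C * rho <= C by rewrite ler_piMr.
have bnd D : tnorm rho J (D \Po Y) <= coef_bound D C.
  apply: le_trans (tnorm_comp _ _ _ (ltW r0)) _.
  apply: le_coef_bound; rewrite ?tnorm_ge0 ?(ltW r0) //; exact: le_trans hY CrC.
have pA := coef_bound_ge0 A C0; have pB := coef_bound_ge0 B C0; have pe := expR_ge0 C.
split.
  apply: le_trans hY _; rewrite ler_wpM2r ?(ltW r0) //.
  by have := mulr_ge0 C0 pA; have := mulr_ge0 pe pB; lra.
apply: le_trans (tnormD _ _ _ (ltW r0)) _; rewrite tnormN.
suff : tnorm rho J (Y * (A \Po Y)) <= C * coef_bound A C /\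
  tnorm rho J ('X * ((1 + Y) ^+ k0 * (B \Po Y))) <= expR C * coef_bound B C by case=> h1 h2; lra.
split.
  apply: le_trans (tnormM _ _ _ (ltW r0)) _.
  by apply: ler_pM; rewrite ?tnorm_ge0 ?(ltW r0) //; exact: le_trans hY CrC.
case: J hY bnd => [|J] hY bnd; first by rewrite /tnorm big_ord0 mulr_ge0.
rewrite tnormXM; apply: le_trans (_ : tnorm rho J.+1 ((1 + Y) ^+ k0 * (B \Po Y)) <= _).
  apply: le_trans (_ : tnorm rho J ((1 + Y) ^+ k0 * (B \Po Y)) <= _).
    by rewrite ler_piMl // tnorm_ge0 // ltW.
  by apply: le_tnorm => //; exact: ltW.
apply: le_trans (tnormM _ _ _ (ltW r0)) _.
apply: ler_pM => //; rewrite ?tnorm_ge0 ?(ltW r0) //.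
apply: le_trans (tnormXn _ _ _ (ltW r0)) _; apply: le_trans (binomial_le_expR k0 C0).
rewrite lerXn2r // ?nnegrE ?addr_ge0 ?tnorm_ge0 ?divr_ge0 ?(ltW r0) //.
apply: le_trans (tnormD _ _ _ (ltW r0)) _; apply: lerD => //.
by rewrite tnorm1 ?(ltW r0).
Qed.

End TruncatedNorm.

(** * The actual root and its distance to the truncated solution *)

Section ImplicitRoot.
Variable R : realType.

Lemma horner_residual (A B Y : {poly R}) k0 u : (residual A B k0 Y).[u] =
  - (Y.[u] * A.[Y.[u]]) + u * ((1 + Y.[u]) ^+ k0 * B.[Y.[u]]).
Proof. by rewrite /residual !hornerE !horner_comp. Qed.

Lemma horner_lipschitz (A : {poly R}) : exists2 L : R, 0 <= L &
  forall y z, `|y| <= 1 -> `|z| <= 1 -> `|A.[y] - A.[z]| <= L * `|y - z|.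
Proof.
elim/poly_ind: A => [|A c [L L0 IH]].
  by exists 0 => // y z _ _; rewrite !horner0 subr0 normr0 mul0r.
exists (coef_bound A 1 + L) => [|y z y1 z1]; first by rewrite addr_ge0 // coef_bound_ge0.
rewrite !hornerMXaddC (_ : _ - _ = A.[y] * (y - z) + (A.[y] - A.[z]) * z); last by ring.
apply: le_trans (ler_normD _ _) _; rewrite [leRHS]mulrDl; apply: lerD; rewrite normrM.
  rewrite ler_wpM2r // horner_coef; apply: le_trans (ler_norm_sum _ _ _) _.
  by apply: ler_sum => i _; rewrite normrM normrX ler_wpM2l // lerXn2r ?nnegrE.
apply: le_trans (_ : L * `|y - z| * 1 <= _); last by rewrite mulr1.
by apply: ler_pM => //; exact: IH.
Qed.

Lemma horner_le_coef_bound (A : {poly R}) y : `|y| <= 1 -> `|A.[y]| <= coef_bound A 1.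
Proof.
move=> y1; rewrite horner_coef; apply: le_trans (ler_norm_sum _ _ _) _.
by apply: ler_sum => i _; rewrite normrM normrX ler_wpM2l // lerXn2r ?nnegrE.
Qed.

Lemma exprn_lipschitz (c a b : R) m : `|a| <= c -> `|b| <= c -> 1 <= c ->
  `|a ^+ m - b ^+ m| <= m%:R * c ^+ m * `|a - b|.
Proof.
move=> ac bc c1; have c0 : 0 <= c by rewrite (le_trans _ c1).
elim: m => [|m IH]; first by rewrite !expr0 subrr normr0 mul0r mul0r.
rewrite (_ : _ - _ = a ^+ m * (a - b) + (a ^+ m - b ^+ m) * b); last by rewrite !exprSr; ring.
apply: le_trans (ler_normD _ _) _; rewrite !normrM normrX.
rewrite [leRHS](_ : _ = c ^+ m * c * `|a - b| + m%:R * c ^+ m * `|a - b| * c); last first.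
  by rewrite -natr1 exprS; ring.
apply: lerD; last by apply: ler_pM.
apply: ler_wpM2r => //; apply: le_trans (_ : c ^+ m <= _).
  by rewrite lerXn2r ?nnegrE.
by rewrite ler_peMr // exprn_ge0.
Qed.

(** On an interval of radius [D mu] the function [F] is close to its linear part, hence separates
    points ([Flip]). The intermediate value theorem gives a root there, and the residual bounds [F]
    at [Y.[mu]], so the root and [Y.[mu]] are close. *)
Lemma implicit_root_expansion_pos (A B : {poly R}) (k : nat) :
  0 < A`_0 -> 0 < B`_0 ->
  exists2 C : R, 0 < C & exists2 dl : R, 0 < dl &
  forall k0 (mu : R) (Y : {poly R}), 0 < mu -> k0.+1%:R * mu <= dl ->
    Y`_0 = 0 -> (size Y <= k.+1)%N ->
    (forall i, (i <= k)%N -> (residual A B k0 Y)`_i = 0) ->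
  exists y, [/\ 0 < y, y <= C * mu, y * A.[y] = mu * ((1 + y) ^+ k0 * B.[y])
    & `|y - Y.[mu]| <= C * (k0.+1%:R * mu) ^+ k.+1].
Proof.
move=> A0 B0.
have [C0 C00 hC0] := residual_bounds B k (lt0r_neq0 A0).
have [LA LA0 lipA] := horner_lipschitz A.
have [LB LB0 lipB] := horner_lipschitz B.
pose b := coef_bound B 1 + 1.
have b0 : 0 < b by rewrite ltr_wpDl // coef_bound_ge0.
pose e : R := expR 1; have e0 : 0 < e by exact: expR_gt0.
(* [D mu] is the search radius: its first term makes [F] nonnegative at the right end, its second
   puts [Y.[mu]] inside. [E * (kp * mu)] bounds the Lipschitz constant of [F] minus its linear part,
   and [W] makes all the required quantities small at once. *)
pose D := 4 * e * b / A`_0 + C0.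
have D0 : 0 < D by rewrite addr_gt0 // divr_gt0 // !mulr_gt0.
pose E := 2 * LA * D + e * (b + LB).
have E0 : 0 < E.
  by apply: ltr_wpDl; [rewrite !mulr_ge0 // ltW|rewrite mulr_gt0 // ltr_wpDr].
pose W := 1 + D + 4 / A`_0 * E.
have W0 : 0 < W by rewrite !addr_gt0 // !mulr_gt0 ?invr_gt0.
exists (D + 2 / A`_0 * C0); first by rewrite addr_gt0 // !mulr_gt0 ?invr_gt0.
exists W^-1; first by rewrite invr_gt0.
move=> k0 mu Y mu0 small Y0 sY N0; set kp := (k0.+1%:R : R) in small *.
have kp1 : 1 <= kp by rewrite ler1n.
have kp0 : 0 < kp by rewrite (lt_le_trans _ kp1).
have kmu0 : 0 < kp * mu by rewrite mulr_gt0.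
have mukm : mu <= kp * mu by rewrite ler_peMl // ltW.
have smallW : kp * mu * W <= 1 by rewrite -ler_pdivlMr // div1r.
have WE : kp * mu * W = kp * mu + D * (kp * mu) + 4 / A`_0 * (E * (kp * mu)) by rewrite /W; ring.
have t1 : 0 <= 4 / A`_0 * (E * (kp * mu)) by rewrite !mulr_ge0 ?invr_ge0 // ltW.
have t2 : 0 <= D * (kp * mu) by rewrite mulr_ge0 // ltW.
have s1 : kp * mu <= 1 by lra.
have s2 : D * (kp * mu) <= 1 by lra.
have s3 : E * (kp * mu) <= A`_0 / 4.
  have : 4 / A`_0 * (E * (kp * mu)) <= 1 by lra.
  rewrite [X in _ -> X <= _](_ : _ = A`_0 / 4 * (4 / A`_0 * (E * (kp * mu)))).
    by move=> h; rewrite ler_piMr // divr_ge0 // ltW.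
  by field; rewrite gt_eqF.
pose r := D * mu.
have r0 : 0 < r by rewrite mulr_gt0.
have r1 : r <= 1 by apply: le_trans s2; rewrite ler_wpM2l // ltW.
(* Here [r <= 1/kp], so [binomial_le_expR] with [c = 1] applies; this is why [kp * mu], and not just
   [mu], must be small. *)
have ek x : `|x| <= 1 + r -> `|x ^+ k0| <= e.
  move=> xr; rewrite normrX; apply: le_trans (_ : (1 + r) ^+ k0 <= _).
    by rewrite lerXn2r // nnegrE // (le_trans _ xr).
  apply: le_trans (_ : (1 + 1 / k0.+1%:R) ^+ k0 <= _); last exact: binomial_le_expR.
  rewrite lerXn2r // ?nnegrE ?addr_ge0 ?divr_ge0 ?(ltW r0) // lerD2l.
  by rewrite ler_pdivlMr // -/kp /r -mulrA [mu * _]mulrC.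
pose F y := y * A.[y] - mu * ((1 + y) ^+ k0 * B.[y]).
have Flip y z : `|y| <= r -> `|z| <= r -> `|y - z| <= 2 / A`_0 * `|F y - F z|.
  move=> yr zr.
  have y1 := le_trans yr r1; have z1 := le_trans zr r1.
  have dA w : `|w| <= r -> `|A.[w] - A`_0| <= LA * r.
    move=> wr; rewrite -horner_coef0; apply: le_trans (lipA _ _ _ _) _; rewrite ?normr0 //.
      exact: le_trans wr r1.
    by rewrite subr0 ler_wpM2l.
  have p1 w : `|w| <= r -> `|1 + w| <= 1 + r.
    by move=> wr; apply: le_trans (ler_normD _ _) _; rewrite normr1 lerD2l.
  have h1 : `|(A.[y] - A`_0) * (y - z) + (A.[y] - A.[z]) * z| <= 2 * LA * r * `|y - z|.
    apply: le_trans (ler_normD _ _) _; rewrite !normrM.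
    rewrite (_ : 2 * LA * r * _ = LA * r * `|y - z| + LA * `|y - z| * r); last by ring.
    by apply: lerD; [rewrite ler_wpM2r // dA|apply: ler_pM => //; exact: lipA].
  have h2 : `|((1 + y) ^+ k0 - (1 + z) ^+ k0) * B.[y] + (1 + z) ^+ k0 * (B.[y] - B.[z])|
      <= e * (b + LB) * kp * `|y - z|.
    apply: le_trans (ler_normD _ _) _; rewrite !normrM.
    apply: le_trans (_ : (kp * e * `|y - z|) * b + e * (kp * LB * `|y - z|) <= _); last first.
      by rewrite le_eqVlt; apply/orP; left; apply/eqP; ring.
    apply: lerD; apply: ler_pM => //.
    - apply: le_trans (exprn_lipschitz k0 (p1 _ yr) (p1 _ zr) _) _.
        by rewrite lerDl ltW.
      rewrite (_ : 1 + y - _ = y - z); last by ring.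
      rewrite ler_wpM2r //; apply: ler_pM => //.
      + by rewrite exprn_ge0 // addr_ge0 // ltW.
      + by rewrite ler_nat.
      + by apply: le_trans (ler_norm _) (ek _ _); rewrite ger0_norm // addr_ge0 // ltW.
    - by apply: le_trans (horner_le_coef_bound _ y1) _; rewrite /b lerDl.
    - by apply: ek; exact: p1.
    - apply: le_trans (lipB _ _ y1 z1) _; rewrite ler_wpM2r //.
      by rewrite ler_peMl.
  have EQ : A`_0 * (y - z) = (F y - F z) - ((A.[y] - A`_0) * (y - z) + (A.[y] - A.[z]) * z)
     + mu * (((1 + y) ^+ k0 - (1 + z) ^+ k0) * B.[y] + (1 + z) ^+ k0 * (B.[y] - B.[z])).
    by rewrite /F; ring.
  have : `|A`_0 * (y - z)| <= `|F y - F z| + 2 * LA * r * `|y - z| + mu * (e * (b + LB) * kp * `|y - z|).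
    rewrite EQ; apply: le_trans (ler_normD _ _) _; apply: lerD.
      by apply: le_trans (ler_normB _ _) _; rewrite lerD2l.
    by rewrite normrM (ger0_norm (ltW mu0)) ler_wpM2l // ltW.
  rewrite normrM (gtr0_norm A0) => h.
  have h3 : 2 * LA * r + mu * (e * (b + LB) * kp) <= E * (kp * mu).
    rewrite /E [leRHS]mulrDl /r; apply: lerD; last by rewrite le_eqVlt; apply/orP; left; apply/eqP; ring.
    by rewrite mulrA ler_wpM2l // !mulr_ge0 // ltW.
  have h4 : 2 * LA * r * `|y - z| + mu * (e * (b + LB) * kp * `|y - z|) <= A`_0 / 4 * `|y - z|.
    rewrite (_ : _ + _ = (2 * LA * r + mu * (e * (b + LB) * kp)) * `|y - z|); last by ring.
    by rewrite ler_wpM2r // (le_trans h3).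
  have n0 : 0 <= A`_0 * `|y - z| by rewrite mulr_ge0 // ltW.
  have : A`_0 * `|y - z| <= 2 * `|F y - F z|.
    move: h h4 n0; rewrite (mulrAC A`_0); set q := A`_0 * _; set f := `|F y - F z|.
    by set u := 2 * _ * _ * _; set v := mu * _ => h h4 n0; lra.
  by rewrite mulrAC ler_pdivlMr // mulrC.
pose Fp : {poly R} := 'X * A - mu%:P * ((1 + 'X) ^+ k0 * B).
have FpE y : Fp.[y] = F y by rewrite /Fp /F !hornerE.
have F0 : Fp.[0] < 0.
  rewrite FpE /F mul0r add0r addr0 expr1n mul1r oppr_lt0 mulr_gt0 //.
  by rewrite horner_coef0.
have Fr : 0 <= Fp.[r].
  rewrite FpE /F.
  have nr : `|r| <= 1 by rewrite ger0_norm // ltW.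
  have a1 : A`_0 / 2 <= A.[r].
    have : `|A.[r] - A`_0| <= LA * r.
      by rewrite -horner_coef0; apply: le_trans (lipA _ _ _ _) _; rewrite ?normr0 // subr0 gtr0_norm.
    have : 2 * (LA * r) <= A`_0 / 4.
      apply: le_trans s3; rewrite /E [leRHS]mulrDl -[leLHS]addr0; apply: lerD.
        by rewrite /r !mulrA -!(mulrA (2 * LA)) -!mulrA !ler_wpM2l // ltW.
      exact: mulr_ge0 (mulr_ge0 (ltW e0) (addr_ge0 (ltW b0) LB0)) (ltW kmu0).
    by rewrite ler_norml => h1 /andP[h2 h3]; move: A0; lra.
  have a2 : (1 + r) ^+ k0 * B.[r] <= e * b.
    apply: le_trans (ler_norm _) _; rewrite normrM; apply: ler_pM => //.
      by apply: ek; rewrite ger0_norm // addr_ge0 // ltW.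
    by apply: le_trans (horner_le_coef_bound _ nr) _; rewrite lerDl.
  rewrite subr_ge0; apply: le_trans (_ : mu * (e * b) <= _).
    by rewrite ler_wpM2l // ltW.
  apply: le_trans (_ : r * (A`_0 / 2) <= _); last by rewrite ler_wpM2l // ltW.
  rewrite [leRHS](_ : _ = mu * (D * (A`_0 / 2))); last by rewrite /r; ring.
  rewrite ler_wpM2l ?(ltW mu0) // /D [leRHS]mulrDl.
  rewrite -[leLHS]addr0; apply: lerD; last by rewrite !mulr_ge0 // ltW.
  rewrite (_ : 4 * e * b / A`_0 * _ = 2 * (e * b)); last by field; rewrite gt_eqF.
  have : 0 <= e * b by rewrite mulr_ge0 // ltW.
  by lra.
have [|y /andP[y0 yr] /rootP Fy] := @poly_ivt _ Fp _ _ (ltW r0); first by rewrite (ltW F0).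
have y_gt0 : 0 < y.
  by rewrite lt_neqAle y0 andbT; apply: contraTneq F0 => y0E; rewrite {1}y0E Fy ltxx.
have Fy0 : F y = 0 by rewrite -FpE.
have [hY hN] := hC0 k0 Y Y0 sY N0 (size Y + size (residual A B k0 Y))%N.
have mu_kp : mu <= kp^-1 by rewrite -[leRHS]mul1r ler_pdivlMr // mulrC.
have kpV0 : 0 < kp^-1 by rewrite invr_gt0.
have Ymu : `|Y.[mu]| <= C0 * mu.
  apply: le_trans (horner_le_tnorm kpV0 (ltW mu0) mu_kp (a := 1) _) _.
    by case.
  rewrite expr1 invrK; apply: le_trans (_ : mu * kp * (C0 / kp) <= _); last first.
    by rewrite le_eqVlt; apply/orP; left; apply/eqP; field; rewrite gt_eqF.
  rewrite ler_wpM2l ?mulr_ge0 ?(ltW mu0) ?(ltW kp0) //; apply: le_trans hY.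
  by apply: le_tnorm; [exact: ltW|exact: leq_addr].
have FY : `|F Y.[mu]| <= C0 * (kp * mu) ^+ k.+1.
  have -> : F Y.[mu] = - (residual A B k0 Y).[mu].
    by rewrite horner_residual /F; ring.
  rewrite normrN.
  apply: le_trans (horner_le_tnorm kpV0 (ltW mu0) mu_kp (a := k.+1) _) _.
    by move=> i; rewrite ltnS; exact: N0.
  rewrite invrK (mulrC mu) [leRHS]mulrC ler_wpM2l ?exprn_ge0 ?(ltW kmu0) //.
  by apply: le_trans hN; apply: le_tnorm; [exact: ltW|exact: leq_addl].
have CA0 : 0 <= 2 / A`_0 by rewrite divr_ge0 // ltW.
exists y; split => //.
- by apply: le_trans yr _; rewrite /r ler_wpM2r ?(ltW mu0) // lerDl mulr_ge0 // ltW.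
- by move/eqP: Fy0; rewrite /F subr_eq0 => /eqP.
- apply: le_trans (Flip _ _ _ _) _.
  + by rewrite gtr0_norm.
  + apply: le_trans Ymu _; rewrite /r ler_wpM2r ?(ltW mu0) //.
    by rewrite /D lerDr divr_ge0 ?(ltW A0) // !mulr_ge0 // ltW.
  rewrite Fy0 sub0r normrN [leRHS]mulrDl -[leLHS]add0r; apply: lerD.
    by rewrite mulr_ge0 ?exprn_ge0 // ltW.
  by rewrite -[leRHS]mulrA ler_wpM2l.
Qed.

(** Only the sign of the product of [G(1)] and [q_tau(1)] is available later, and the equation is
    invariant under changing the signs of both [A] and [B]. *)
Lemma implicit_root_expansion (A B : {poly R}) (k : nat) : 0 < A`_0 * B`_0 ->
  exists2 C : R, 0 < C & exists2 dl : R, 0 < dl &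
  forall k0 (mu : R) (Y : {poly R}), 0 < mu -> k0.+1%:R * mu <= dl ->
    Y`_0 = 0 -> (size Y <= k.+1)%N ->
    (forall i, (i <= k)%N -> (residual A B k0 Y)`_i = 0) ->
  exists y, [/\ 0 < y, y <= C * mu, y * A.[y] = mu * ((1 + y) ^+ k0 * B.[y])
    & `|y - Y.[mu]| <= C * (k0.+1%:R * mu) ^+ k.+1].
Proof.
move=> AB0; have [A0|A0|A0] := ltgtP 0 A`_0; last by rewrite -A0 mul0r ltxx in AB0.
  by apply: implicit_root_expansion_pos => //; rewrite pmulr_rgt0 in AB0.
have [||C C0 [dl dl0 H]] := @implicit_root_expansion_pos (- A) (- B) k.
- by rewrite coefN oppr_gt0.
- by rewrite coefN oppr_gt0 -(nmulr_rgt0 _ A0).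
exists C => //; exists dl => // k0 mu Y mu0 small Y0 sY N0.
have [|y [y0 yC + hy]] := H k0 mu Y mu0 small Y0 sY.
  move=> i /N0; rewrite (_ : residual (- A) _ _ _ = - residual A B k0 Y) ?coefN.
    by move=> ->; rewrite oppr0.
  by rewrite /residual !raddfN /=; ring.
by rewrite !hornerN !mulrN => /oppr_inj; exists y.
Qed.
End ImplicitRoot.

(** * From vanishing derivatives of a fraction to vanishing coefficients of its numerator *)

Section DerivativesOfFractions.
Variable R : realType.
Implicit Types A D : {poly R}.

Lemma near_horner_neq0 D (u : R) : D.[u] != 0 -> \forall v \near u, D.[v] != 0.
Proof. exact: (cvgr_neq0 D.[u] (@continuous_horner R D u)). Qed.

Lemma derive1_fraction A D (u : R) : D.[u] != 0 ->
  (fun v => A.[v] / D.[v])^`()%classic u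
    = (A^`() * D - A * D^`()).[u] / (D ^+ 2).[u].
Proof.
move=> Du; rewrite derive1E.
have dD := is_deriveV Du (is_derive_poly D u).
have /@derive_val -> := is_deriveM (is_derive_poly A u) dD.
by rewrite !hornerE /GRing.scale /=; field.
Qed.

(** Formulas for fractions hold only where the denominator is nonzero, so they are iterated as
    identities of germs. *)
Lemma near_eq_derive1n (f g : R -> R) (u : R) m : (\forall v \near u, f v = g v) ->
  \forall v \near u, f^`(m)%classic v = g^`(m)%classic v.
Proof.
move=> fg; elim: m => [|m IH]; first by rewrite !derive1n0.
rewrite !derive1nS.
apply: filterS (near_join IH) => v; rewrite !derive1E.
exact: near_eq_derive.
Qed.

(** [D] is invertible as a power series. *)
Lemma coefM_eq0 A D k : D.[0] != 0 -> (forall i, (i <= k)%N -> (A * D)`_i = 0) ->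
  forall i, (i <= k)%N -> A`_i = 0.
Proof.
move=> D0 AD0; elim/ltn_ind => i IH ik.
have := AD0 i ik; rewrite coefM big_ord_recr /= subnn -horner_coef0 big1 ?add0r => [/eqP|l _].
  by rewrite mulf_eq0 (negPf D0) orbF => /eqP.
by rewrite IH ?mul0r // (leq_trans _ ik) // ltnW.
Qed.

(** Induction on [k]: the derivative of [A/D] is again a fraction, with numerator [A' D - A D'], and
    its derivatives of order up to [k] vanish at 0. As the low coefficients of [A] vanish by
    induction, so do those of [A' D], and [D] can be divided out. *)
Lemma derive1n_fraction_eq0 A D k : D.[0] != 0 -> A.[0] = 0 ->
  (forall m, (1 <= m <= k)%N -> (fun v => A.[v] / D.[v])^`(m)%classic 0 = 0) ->
  forall i, (i <= k)%N -> A`_i = 0.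
Proof.
elim: k A D => [|k IH] A D D0 A0 H i.
  by rewrite leqn0 => /eqP ->; rewrite -horner_coef0.
have Ak j : (j <= k)%N -> A`_j = 0.
  apply: (IH A D) => // m /andP[m1 mk]; apply: H; rewrite m1 /=; exact: leqW.
have D20 : (D ^+ 2).[0] != 0 by rewrite hornerE expf_neq0.
have A1 j : (j <= k)%N -> (A^`() * D - A * D^`())`_j = 0.
  have nD : \forall v \near 0, (fun v => A.[v] / D.[v])^`()%classic v
      = (A^`() * D - A * D^`()).[v] / (D ^+ 2).[v].
    by apply: filterS (near_horner_neq0 D0) => v; exact: derive1_fraction.
  apply: (IH _ (D ^+ 2)) => //.
    have := nbhs_singleton nD; rewrite -derive1n1 H // => /esym/eqP.
    by rewrite mulf_eq0 invr_eq0 (negPf D20) orbF => /eqP.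
  move=> m /andP[m1 mk].
  have := nbhs_singleton (near_eq_derive1n m nD); rewrite -derive1Sn H // => <- //.
have A'0 j : (j <= k)%N -> A^`()`_j = 0.
  apply: (coefM_eq0 (D := D)) => // l lk.
  have := A1 l lk; rewrite coefB => /eqP; rewrite subr_eq0 => /eqP ->.
  rewrite coefM big1 // => h _; rewrite Ak ?mul0r //.
  by apply: leq_trans lk; rewrite -ltnS.
case: i => [|i] ik; first by rewrite -horner_coef0.
by have /eqP := A'0 i ik; rewrite coef_deriv mulrn_eq0 /= => /eqP.
Qed.
End DerivativesOfFractions.

(** * Words, paths and the maximum principle *)

Section Words.
Variables (R : realType) (S : finType) (a0 : S) (P : S -> S -> R) (n : nat).
Implicit Types (u w tau : n.-tuple S).

Let step : rel S := fun a b => 0 < P a b.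

Definition next_word u a : n.-tuple S := [tuple of behead (rcons u a)].

Lemma admissible_wordE (w : seq S) : admissible_word P w = sorted step w.
Proof.
rewrite /admissible_word; case: w => //= a w.
by elim: w a => //= b w IH a; rewrite IH.
Qed.

Lemma next_word_admissible u a : (0 < n)%N ->
  admissible_word P u -> 0 < P (last a0 u) a -> admissible_word P (next_word u a).
Proof.
rewrite !admissible_wordE /=; case: u => -[|x s] /= sz n0.
  by rewrite -(eqP sz) in n0.
by move=> xs Pa; apply: (@path_sorted _ _ x); rewrite rcons_path xs.
Qed.

Lemma foldl_next_word w (e : seq S) :
  foldl next_word w e = drop (size e) (w ++ e) :> seq S.
Proof.
elim: e w => [|a e IH] w /=; first by rewrite drop0 cats0.
rewrite IH /= -cat_rcons; case: (w : seq S) => [|b s] /=; last by [].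
by case: w => -[].
Qed.

Lemma Ppow_ge0 m a b : nonneg_mx P -> 0 <= Ppow P m a b.
Proof.
move=> P0; elim: m b => [|m IH] b /=; first exact: ler0n.
by apply: sumr_ge0 => c _; rewrite mulr_ge0.
Qed.

Lemma Ppow_path m a b : nonneg_mx P -> 0 < Ppow P m.+1 a b ->
  exists e, path step a (rcons e b).
Proof.
move=> P0; elim: m b => [|m IH] b.
  rewrite /= (bigD1 a) //= eqxx mul1r big1 ?addr0 => [Pab|c ca].
    by exists [::]; rewrite /= andbT.
  by rewrite eq_sym (negPf ca) mul0r.
move=> pos; have {}pos : 0 < \sum_(c : S) Ppow P m.+1 a c * P c b by exact: pos.
have [c hc|H] := pickP (fun c => Ppow P m.+1 a c * P c b != 0); last first.
  by move: pos; rewrite big1 ?ltxx // => c _; have /negbFE/eqP := H c.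
have [|e he] := IH c.
  have := Ppow_ge0 m.+1 a c P0; rewrite le_eqVlt => /orP[/eqP h|//].
  by rewrite -h mul0r eqxx in hc.
exists (rcons e c); rewrite rcons_path he last_rcons /= /step.
have := P0 c b; rewrite le_eqVlt => /orP[/eqP h|//].
by rewrite -h mulr0 eqxx in hc.
Qed.

(** Irreducibility leads to the first letter of [tau]; the rest of [tau] is then spelled out, so
    that the sliding window ends at [tau]. *)
Lemma admissible_reach tau a : nonneg_mx P -> irreducible P -> (0 < n)%N ->
  admissible_word P tau -> exists e : seq S, path step a (e ++ tau).
Proof.
move=> P0 irr n0; rewrite admissible_wordE; case: tau => -[|b s] /= sz hs.
  by rewrite -(eqP sz) in n0.
have [m /(Ppow_path P0)[e he]] := irr a b.
by exists e; rewrite -cat_rcons cat_path he last_rcons.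
Qed.

(** At a word where the maximum is attained, harmonicity forces all successors of positive
    probability to attain it too. Following a path to [tau], and stopping at the first visit since
    [f] need not be harmonic there, shows that the maximum is [f tau = 0]. *)
Lemma word_le_max_principle tau (f : n.-tuple S -> R) :
  nonneg_mx P -> row_stochastic P -> irreducible P -> (0 < n)%N ->
  admissible_word P tau -> f tau = 0 ->
  (forall w, admissible_word P w -> w != tau ->
     f w = \sum_a P (last a0 w) a * f (next_word w a)) ->
  forall w, admissible_word P w -> f w <= 0.
Proof.
move=> P0 P1 irr n0 taua f0 harm.
case: (@arg_maxP _ _ _ tau (fun w => admissible_word P w) f taua) => w wa wmax.
suff fw : f w = 0 by move=> v va; rewrite -fw; exact: wmax.
have gen e (v : n.-tuple S) : admissible_word P v -> f v = f w -> foldl next_word v e = tau ->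
    path step (last a0 v) e -> f w = 0.
  elim: e v => [|a e IH] v va fv /= hv hp; first by rewrite -fv hv.
  have [vt|vt] := eqVneq v tau; first by rewrite -fv vt.
  case/andP: hp => pa hp.
  have na b : 0 < P (last a0 v) b -> admissible_word P (next_word v b).
    exact: next_word_admissible.
  apply: (IH (next_word v a)) => //; first exact: na.
    have sum0 : \sum_b P (last a0 v) b * (f w - f (next_word v b)) = 0.
      under eq_bigr do rewrite mulrBr.
      by rewrite sumrB -mulr_suml P1 mul1r -harm // fv subrr.
    have ge0 b : true -> 0 <= P (last a0 v) b * (f w - f (next_word v b)).
      move=> _; have := P0 (last a0 v) b; rewrite le_eqVlt => /orP[/eqP <-|pb].
        by rewrite mul0r.
      by rewrite mulr_ge0 ?(ltW pb) // subr_ge0; apply: wmax; exact: na.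
    have /(_ a isT)/eqP := psumr_eq0P ge0 sum0.
    by rewrite mulf_eq0 gt_eqF //= subr_eq0 => /eqP.
  rewrite (_ : last a0 (next_word v a) = a) //.
  case: (v) n0 => -[|b s] //= sz; first by rewrite -(eqP sz).
  by rewrite last_rcons.
have [e he] := admissible_reach (last a0 w) P0 irr n0 taua.
apply: (gen (e ++ tau) w) => //.
by apply: val_inj; rewrite /= foldl_next_word catA drop_size_cat // !size_cat !size_tuple addnC.
Qed.

Lemma word_max_principle tau (f : n.-tuple S -> R) :
  nonneg_mx P -> row_stochastic P -> irreducible P -> (0 < n)%N ->
  admissible_word P tau -> f tau = 0 ->
  (forall w, admissible_word P w -> w != tau ->
     f w = \sum_a P (last a0 w) a * f (next_word w a)) ->
  forall w, admissible_word P w -> f w = 0.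
Proof.
move=> P0 P1 irr n0 taua f0 harm w wa; apply/eqP; rewrite eq_le.
rewrite (word_le_max_principle P0 P1 irr n0 taua f0 harm wa) /= -oppr_le0.
apply: (word_le_max_principle (f := fun w => - f w) P0 P1 irr n0 taua _ _ wa).
  by rewrite f0 oppr0.
move=> v va vt; rewrite harm // -sumrN; apply: eq_bigr => b _; by rewrite mulrN.
Qed.

End Words.

(** * The block matrix and its cofactors *)

Section BlockRecursion.
Variables (R : realType) (S : finType) (a0 : S) (P : S -> S -> R) (n : nat).
Variable kc : n.-tuple S -> nat.
Implicit Types (u w tau : n.-tuple S).
Hypotheses (P0 : nonneg_mx P) (P1 : row_stochastic P) (irr : irreducible P).
Hypothesis n0 : (0 < n)%N.
Hypothesis kc_pos : forall w, admissible_word P w -> (1 <= kc w)%N.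

Local Notation block := (blockT P kc).
Local Notation Cp := (@Cpoly R S P n kc).

Lemma kc_lt_Kmax w : (kc w < Kmax kc)%N.
Proof. by rewrite ltnS; exact: (leq_bigmax w). Qed.

(** Reads a vector on blocks at any pair of a word and a level, with value 0 outside the blocks, so
    that sums over letters need no side condition. *)
Definition block_val (V : zmodType) (v : block -> V) w (j : nat) : V :=
  if insub (w, inord j : 'I_(Kmax kc)) is Some b then v b else 0.

Lemma block_valE (V : zmodType) (v : block -> V) (b : block) :
  block_val v (val b).1 (val b).2 = v b.
Proof.
rewrite /block_val inord_val -surjective_pairing.
by rewrite valK.
Qed.

Lemma exists_block w j : admissible_word P w -> (j < kc w)%N ->
  exists b : block, (val b).1 = w /\ (val b).2 = j :> nat.
Proof.
move=> wa jk.
have jK : (j < Kmax kc)%N := ltn_trans jk (kc_lt_Kmax w).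
have hb : admissible_word P (w, Ordinal jK).1 && (nat_of_ord (w, Ordinal jK).2 < kc (w, Ordinal jK).1)%N.
  by rewrite /= wa jk.
by exists (Sub (w, Ordinal jK) hb : block); rewrite SubK.
Qed.

Lemma block_inj (b b' : block) : (val b).1 = (val b').1 ->
  (val b).2 = (val b').2 :> nat -> b = b'.
Proof.
move=> h1 h2; apply: val_inj; rewrite (surjective_pairing (val b)) h1 (surjective_pairing (val b')).
by congr pair; apply: val_inj.
Qed.

Lemma tuple_last_eq w u a : (behead w == take n.-1 u) -> last a0 u = a -> u = next_word w a.
Proof.
move=> /eqP h1 h2; apply: val_inj => /=; case: w h1 => -[|x s] /= sz h1.
  by have := n0; rewrite ltnNge => /negP[]; rewrite -(eqP sz).
rewrite h1 -h2; case: u {h1 h2} => s' /= /eqP sz'.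
case/lastP: s' sz' => [sz'|s' y]; first by have := n0; rewrite ltnNge => /negP[]; rewrite -sz'.
by rewrite size_rcons last_rcons => <- /=; rewrite -cats1 take_size_cat // cats1.
Qed.

Lemma trans_lastE w u : trans_last P w u = P (last a0 w) (last a0 u).
Proof.
case: w => -[|x s] /= sz; first by have := n0; rewrite ltnNge => /negP[]; rewrite -(eqP sz).
by case: u => -[|y s'] /= sz' //; have := n0; rewrite ltnNge => /negP[]; rewrite -(eqP sz').
Qed.

Lemma sum_mbar_low (V : lmodType R) (v : block -> V) (b : block) :
  ((val b).2.+1 < kc (val b).1)%N ->
  \sum_b' mbar b b' *: v b' = block_val v (val b).1 (val b).2.+1.
Proof.
move=> jk; have /andP[wa _] := valP b.
have [b1 [e1 e2]] := exists_block wa jk.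
rewrite (bigD1 b1) //= big1 ?addr0 => [|b' nb].
  by rewrite /mbar jk e1 e2 !eqxx /= scale1r -e1 -e2 block_valE.
rewrite /mbar jk; case: eqP => [h1|_]; last by rewrite scale0r.
case: eqP => [h2|_]; last by rewrite scale0r.
by case/eqP: nb; apply: block_inj; rewrite ?e1 ?e2.
Qed.

(** Sorting blocks by their last letter leaves one successor per letter of positive probability. A
    letter of probability 0 contributes 0 on both sides, even if its word is not a block. *)
Lemma sum_mbar_top (V : lmodType R) (v : block -> V) (b : block) :
  ((val b).2.+1 < kc (val b).1)%N = false ->
  \sum_b' mbar b b' *: v b'
    = \sum_a P (last a0 (val b).1) a *: block_val v (next_word (val b).1 a) 0.
Proof.
move=> jk; have /andP[wa _] := valP b; set w := (val b).1.
rewrite (partition_big (fun b' : block => last a0 (val b').1) xpredT) //=.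
apply: eq_bigr => a _.
have [pa|] := ltP 0 (P (last a0 w) a); last first.
  move=> pa; have {}pa : P (last a0 w) a = 0 by apply/eqP; rewrite eq_le pa P0.
  rewrite pa scale0r big1 // => b' /eqP la; rewrite /mbar jk.
  by case: ifP => _; rewrite ?scale0r // trans_lastE la pa scale0r.
have na := next_word_admissible n0 wa pa.
have [b1 [e1 e2]] := exists_block na (kc_pos na).
have lasta : last a0 (next_word w a) = a.
  case: (w) => -[|x s] //= sz; first by have := n0; rewrite ltnNge => /negP[]; rewrite -(eqP sz).
  by rewrite last_rcons.
have tk : behead w = take n.-1 (next_word w a).
  case: (w) => -[|x s] //= sz.
  by rewrite -(eqP sz) /= -cats1 take_size_cat.
have vb1 : block_val v (next_word w a) 0 = v b1.
  by rewrite -(block_valE v b1) e1 e2.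
rewrite (bigD1 b1) ?e1 ?lasta //= big1 ?addr0 => [|b' /andP[/eqP la nb]].
  by rewrite /mbar jk trans_lastE e1 e2 eqxx -/w -tk eqxx /= lasta vb1.
rewrite /mbar jk; case: eqP => [h2|_] /=; last by rewrite scale0r.
case: ifP => [h1|_]; last by rewrite scale0r.
case/eqP: nb; apply: block_inj; rewrite ?e1 ?e2 //.
exact: tuple_last_eq la.
Qed.

(* [v] solves (id - z Mbar) v = d e_(tau,0); eliminating the levels leaves an equation on words. *)
Lemma block_recursion (V : lmodType R) (v : block -> V) (z : V -> V) tau (d : V)
    (H := fun w => \sum_a P (last a0 w) a *: block_val v (next_word w a) 0) :
  (forall b, v b = z (\sum_b' mbar b b' *: v b')
     + d *+ (((val b).1 == tau) && (nat_of_ord (val b).2 == 0%N))) ->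
  forall w, admissible_word P w -> forall i j, (j + i.+1 = kc w)%N ->
    block_val v w j = iter i.+1 z (H w) + d *+ ((w == tau) && (j == 0%N)).
Proof.
move=> eqv w wa; elim=> [|i IH] j ji.
  have jk : (j < kc w)%N by rewrite -ji addn1.
  have [b [e1 e2]] := exists_block wa jk.
  rewrite -e1 -e2 block_valE eqv sum_mbar_top // e1 e2 -ji addn1 ltnn //.
have jk : (j < kc w)%N by rewrite -ji addnS ltnS leq_addr.
have jk1 : (j.+1 < kc w)%N by rewrite -ji !addnS !ltnS leq_addr.
have [b [e1 e2]] := exists_block wa jk.
rewrite -e1 -e2 block_valE eqv sum_mbar_low ?e1 ?e2 // IH; last by rewrite -ji addSnnS.
by rewrite andbF mulr0n addr0.
Qed.

Lemma sum_enum_block (V : zmodType) (F : block -> V) :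
  \sum_(j < #|block|) F (enum_val j) = \sum_b F b.
Proof.
rewrite (reindex enum_rank) /=; last exact/onW_bij/enum_rank_bij.
by apply: eq_bigr => b _; rewrite enum_rankK.
Qed.

Lemma Apoly_mulcol (v : 'I_#|block| -> {poly R}) i :
  \sum_j Apoly P kc i j * v j
    = v i - 'X * \sum_b' mbar (enum_val i) b' *: v (enum_rank b').
Proof.
rewrite -[X in _ - _ * X](sum_enum_block (fun b' => mbar (enum_val i) b' *: v (enum_rank b'))).
rewrite mulr_sumr -sumrN.
have -> : v i = \sum_j (i == j)%:R * v j.
  rewrite (bigD1 i) //= eqxx mul1r big1 ?addr0 // => j ji.
  by rewrite eq_sym (negPf ji) mul0r.
rewrite -big_split; apply: eq_bigr => j _ /=.
by rewrite /Apoly !mxE enum_valK mulrBl -mulrA mul_polyC.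
Qed.

Lemma Apoly1_mulcol (v : 'I_#|block| -> R) i :
  \sum_j (Apoly P kc i j).[1] * v j
    = v i - \sum_b' mbar (enum_val i) b' *: (v (enum_rank b') : R^o).
Proof.
have := congr1 (horner^~ 1) (Apoly_mulcol (fun j => (v j)%:P) i).
rewrite /= horner_sum => E.
have -> : \sum_j (Apoly P kc i j).[1] * v j = \sum_j (Apoly P kc i j * (v j)%:P).[1].
  by apply: eq_bigr => j _; rewrite hornerM hornerC.
rewrite E !hornerE horner_sum; congr (_ - _); apply: eq_bigr => b' _.
by rewrite !hornerE.
Qed.

Variable tau : n.-tuple S.
Hypothesis taua : admissible_word P tau.

(** At [z = 1] the rows of [Mbar] sum to 1, so the constant vector is in the kernel. The transpose
    appears because [det0P] speaks of row vectors. *)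
Lemma det_Apoly1 : (\det (Apoly P kc)).[1] = 0.
Proof.
have -> : (\det (Apoly P kc)).[1] = \det (map_mx (horner_eval 1) (Apoly P kc))^T.
  by rewrite det_tr det_map_mx.
have [b _] := exists_block taua (kc_pos taua).
apply/eqP/det0P; exists (const_mx 1).
  by apply/eqP => /rowP /(_ (enum_rank b)); rewrite !mxE; apply/eqP; exact: oner_neq0.
apply/rowP => i; rewrite !mxE.
transitivity (\sum_j (Apoly P kc i j).[1] * (fun _ : 'I_#|block| => 1) j).
  by apply: eq_bigr => j _; rewrite !mxE /horner_eval mulrC.
rewrite Apoly1_mulcol; apply/eqP; rewrite subr_eq0 eq_sym; apply/eqP.
set b1 := enum_val i; have /andP[wa _] := valP b1.
have block1 w j : admissible_word P w -> (j < kc w)%N ->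
    block_val (fun _ : block => (1 : R^o)) w j = 1.
  by move=> ha hj; have [b2 [<- <-]] := exists_block ha hj; rewrite block_valE.
have [jk|jk] := boolP ((val b1).2.+1 < kc (val b1).1)%N.
  by rewrite (sum_mbar_low _ jk) block1.
rewrite (sum_mbar_top _ (negbTE jk)); apply: etrans (P1 (last a0 (val b1).1)); apply: eq_bigr => a _.
have := P0 (last a0 (val b1).1) a; rewrite le_eqVlt => /orP[/eqP <-|pa].
  by rewrite scale0r.
have na := next_word_admissible n0 wa pa.
by rewrite block1 ?kc_pos //; exact: mulr1.
Qed.

Lemma det_ApolyE : \det (Apoly P kc) = (1 - 'X) * Gpoly P kc.
Proof.
rewrite mulrC /Gpoly divpK // -dvdpNl opprB -[1]/(1%:P) dvdp_XsubCl.
by apply/rootP; exact: det_Apoly1.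
Qed.

(** The [q_w] of the overview. *)
Definition adj_col w : {poly R} :=
  block_val (fun b : block => Cp (tau, ord0) (val b)) w 0.

Lemma blk_index_val (b : block) : @blk_index R S P n kc (val b) = Some (enum_rank b).
Proof. by rewrite /blk_index valK. Qed.

Lemma exists_tau_block : exists b : block, val b = (tau, ord0).
Proof.
have [b [e1 e2]] := exists_block taua (kc_pos taua); exists b.
by rewrite (surjective_pairing (val b)) e1; congr pair; apply: val_inj.
Qed.

Lemma adj_col_tau : adj_col tau = Cp (tau, ord0) (tau, ord0).
Proof.
have [b e] := exists_tau_block.
by have := block_valE (fun b : block => Cp (tau, ord0) (val b)) b; rewrite e.
Qed.

(** This is the column of the block [(tau, 0)] in the identity matrix times adjugate equals
    determinant, with the levels above the ground eliminated; each level contributes one factor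
    ['X]. *)
Lemma adj_col_rec w : admissible_word P w ->
  adj_col w = 'X ^+ kc w * (\sum_a P (last a0 w) a *: adj_col (next_word w a))
    + ((1 - 'X) * Gpoly P kc) *+ (w == tau).
Proof.
move=> wa; have [t e] := exists_tau_block.
have main (b : block) : Cp (tau, ord0) (val b) = 'X * (\sum_b' mbar b b' *: Cp (tau, ord0) (val b'))
    + \det (Apoly P kc) *+ (((val b).1 == tau) && (nat_of_ord (val b).2 == 0%N)).
  have CE b' : Cp (tau, ord0) (val b') = (\adj (Apoly P kc)) (enum_rank b') (enum_rank t).
    by rewrite /Cpoly -e !blk_index_val mxE.
  have := congr1 (fun M : 'M[{poly R}]_#|block| => M (enum_rank b) (enum_rank t)) (mul_mx_adj (Apoly P kc)).
  rewrite !mxE (Apoly_mulcol (fun j => (\adj (Apoly P kc)) j (enum_rank t))) enum_rankK.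
  move=> /eqP; rewrite subr_eq => /eqP; rewrite CE => ->; rewrite addrC; congr (_ + _).
    by congr ('X * _); apply: eq_bigr => b' _; rewrite CE.
  congr (_ *+ _); rewrite (inj_eq enum_rank_inj) -(inj_eq val_inj) e.
  by rewrite (surjective_pairing (val b)) xpair_eqE.
have := block_recursion (z := fun p => 'X * p) main wa (i := (kc w).-1) (j := 0).
rewrite add0n prednK ?kc_pos // eqxx andbT det_ApolyE /adj_col => -> //; congr (_ + _).
by elim: (kc w) => [|m IH]; rewrite ?expr0 ?mul1r // iterS IH exprS mulrA.
Qed.

(** A vanishing minor has a nonzero kernel vector. Extended by 0 to the removed block, it is
    harmonic off [tau] and zero at [tau], so the maximum principle kills it. *)
Lemma adj_col_tau1_neq0 : (adj_col tau).[1] != 0.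
Proof.
have [t e] := exists_tau_block; set i0 := enum_rank t.
rewrite adj_col_tau -e /Cpoly blk_index_val -/i0.
apply/negP => /eqP C0.
pose M := map_mx (horner_eval 1) (Apoly P kc).
have /eqP : cofactor M i0 i0 = 0 by rewrite /M cofactor_map_mx; exact: C0.
rewrite /cofactor mulf_eq0 signr_eq0 /= -det_tr => /det0P[v vn0 vM].
pose u j := if unlift i0 j is Some k then v 0 k else 0.
have u0 : u i0 = 0 by rewrite /u unlift_none.
have uk k : u (lift i0 k) = v 0 k by rewrite /u liftK.
have Mu i : i != i0 -> \sum_j (Apoly P kc i j).[1] * u j = 0.
  move=> ii; case: (unliftP i0 i) ii => [k ->|->]; last by rewrite eqxx.
  move=> _; rewrite (@bigD1_ord _ _ _ _ i0) //= u0 mulr0 add0r.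
  have /rowP/(_ k) := vM; rewrite !mxE => h; apply: etrans h; apply: eq_bigr => l _.
  by rewrite !mxE uk mulrC.
pose ub (b : block) : R^o := u (enum_rank b).
have ueq b : b != t -> ub b = \sum_b' mbar b b' *: ub b'.
  move=> bt; have := Mu (enum_rank b); rewrite (inj_eq enum_rank_inj) => /(_ bt).
  by rewrite Apoly1_mulcol enum_rankK => /eqP; rewrite subr_eq0 => /eqP.
(* The equation at the removed block may fail; [d] is its defect there, shown to be 0 below, which
   then clears the higher levels. *)
pose d : R^o := - \sum_b' mbar t b' *: ub b'.
have rec := @block_recursion _ ub id tau d.
have {}rec : forall w, admissible_word P w -> forall i j, (j + i.+1)%N = kc w ->
    block_val ub w j = (\sum_a P (last a0 w) a *: block_val ub (next_word w a) 0)
      + d *+ ((w == tau) && (j == 0%N)).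
  move=> w wa i j ji; rewrite (rec _ w wa i j ji).
    by congr (_ + _); elim: (i) => //= m ->.
  move=> b; have [->|bt] := eqVneq b t.
    by rewrite e !eqxx /= /d mulr1n subrr /ub u0.
  rewrite (ueq _ bt) (_ : _ && _ = false) ?addr0 //.
  apply: contraNF bt => /andP[/eqP h1 /eqP h2].
  by apply/eqP; apply: block_inj; rewrite e.
have f0 : block_val ub tau 0 = 0.
  by have := block_valE ub t; rewrite e /= => ->; rewrite /ub u0.
have f_eq0 w : admissible_word P w -> block_val ub w 0 = 0.
  apply: (@word_max_principle _ _ a0 _ _ tau (fun w => block_val ub w 0) P0 P1 irr n0 taua f0 _ w).
  by move=> v1 va vt; rewrite (rec v1 va (kc v1).-1) ?add0n ?prednK ?kc_pos // (negPf vt) addr0.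
have d0 : d = 0.
  have := rec tau taua (kc tau).-1 0%N; rewrite add0n prednK ?kc_pos // => /(_ erefl).
  rewrite f0 !eqxx mulr1n big1 ?add0r // => a _.
  have := P0 (last a0 tau) a; rewrite le_eqVlt => /orP[/eqP <-|pa]; first by rewrite scale0r.
  by rewrite f_eq0 ?scaler0 //; exact: next_word_admissible pa.
case/eqP: vn0; apply/rowP => k; rewrite !mxE -uk.
rewrite -(enum_valK (lift i0 k)); set b := enum_val _.
rewrite -/(ub b) -block_valE; have /andP[wa jk] := valP b.
rewrite (rec _ wa (kc (val b).1 - (val b).2).-1); last first.
  by rewrite prednK ?subn_gt0 // subnKC // ltnW.
rewrite d0 mul0rn addr0 big1 // => a _.
have := P0 (last a0 (val b).1) a; rewrite le_eqVlt => /orP[/eqP <-|pa]; first by rewrite scale0r.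
by rewrite f_eq0 ?scaler0 //; exact: next_word_admissible pa.
Qed.

(** At [z = 1] the column is harmonic off [tau], hence constant. *)
Lemma adj_col1 w : admissible_word P w -> (adj_col w).[1] = (adj_col tau).[1].
Proof.
move=> wa; apply/eqP; rewrite -subr_eq0; apply/eqP; move: w wa.
apply: (@word_max_principle _ _ a0 _ _ tau (fun w => (adj_col w).[1] - (adj_col tau).[1]) P0 P1 irr n0 taua); first exact: subrr.
move=> w wa wt; rewrite {1}adj_col_rec // (negPf wt) addr0 hornerM horner_exp hornerX expr1n mul1r.
under [RHS]eq_bigr do rewrite mulrBr.
rewrite sumrB -mulr_suml P1 mul1r horner_sum; congr (_ - _).
by apply: eq_bigr => a _; rewrite hornerZ.
Qed.

End BlockRecursion.

(** * Positivity of the harmonic ratio, and the sign of G at 1 *)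

Section PositivityNearOne.
Variables (R : realType) (S : finType) (a0 : S) (P : S -> S -> R) (n : nat).
Variable kc : n.-tuple S -> nat.
Implicit Types (u w : n.-tuple S).
Hypotheses (P0 : nonneg_mx P) (P1 : row_stochastic P) (irr : irreducible P).
Hypothesis n0 : (0 < n)%N.
Hypothesis kc_pos : forall w, admissible_word P w -> (1 <= kc w)%N.
Variable tau : n.-tuple S.
Hypothesis taua : admissible_word P tau.

Local Notation q := (adj_col P kc tau).

Lemma near_horner_gt0 (p : {poly R}) : 0 < p.[1] -> \forall z \near (1 : R), 0 < p.[z].
Proof. exact: (cvgr_gt p.[1] (@continuous_horner R p 1)). Qed.

Lemma near1_interval (Q : R -> Prop) : (\forall z \near (1 : R), Q z) ->
  exists2 dl : R, 0 < dl & forall z, 1 <= z -> z <= 1 + dl -> Q z.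
Proof.
move=> /nbhs_ballP[e /= e0 H]; exists (e / 2); first by rewrite divr_gt0.
move=> z z1 ze; apply: H; rewrite /ball /= distrC ger0_norm ?subr_ge0 //.
by move: e0; lra.
Qed.

Definition eigen_ratio (z : R) w : R := (q w).[z] / (q tau).[z].

(** At [z = 1] every product [q w * q tau] equals the square of [q tau], which is positive;
    continuity and the finite number of words do the rest. Products are used because the sign of
    [q tau] is not known. *)
Lemma eigen_ratio_near1 : exists2 dl : R, 0 < dl & forall z, 1 <= z -> z <= 1 + dl ->
  (q tau).[z] != 0 /\ forall w, admissible_word P w -> 0 < eigen_ratio z w.
Proof.
have H : \forall z \near (1 : R), forall w, admissible_word P w -> 0 < (q w * q tau).[z].
  apply: (@filter_forall R _ (fun w z => admissible_word P w -> 0 < (q w * q tau).[z]) _ (nbhs_filter (1 : R))) => w.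
  have [wa|wa] := boolP (admissible_word P w); last by apply: nearW.
  have h : 0 < (q w * q tau).[1].
    rewrite hornerM (adj_col1 a0) // -expr2 exprn_even_gt0 //.
    exact: (adj_col_tau1_neq0 a0).
  exact: filterS (near_horner_gt0 h).
have [dl dl0 {}H] := near1_interval H.
exists dl => // z z1 zd; have {}H := H z z1 zd; have := H tau taua.
rewrite hornerM -expr2 exprn_even_gt0 //= => qt; split => // w wa.
have := H w wa; rewrite hornerM /eigen_ratio => h.
rewrite (_ : _ / _ = (q w).[z] * (q tau).[z] / (q tau).[z] ^+ 2); last by field.
by rewrite divr_gt0 // exprn_even_gt0.
Qed.

Lemma eigen_ratio_rec z w : (q tau).[z] != 0 -> admissible_word P w ->
  eigen_ratio z w = z ^+ kc w * (\sum_a P (last a0 w) a * eigen_ratio z (next_word w a))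
    + ((1 - z) * (Gpoly P kc).[z] / (q tau).[z]) *+ (w == tau).
Proof.
move=> qt wa; rewrite /eigen_ratio {1}(adj_col_rec a0 P0 P1 n0 kc_pos taua wa).
rewrite hornerD mulrDl hornerM horner_exp hornerX; congr (_ + _).
  rewrite -mulrA; congr (_ * _); rewrite horner_sum mulr_suml; apply: eq_bigr => a _.
  by rewrite hornerZ mulrA.
by case: (w == tau); rewrite ?mulr0n ?horner0 ?mul0r // !mulr1n !hornerE.
Qed.

(** For [z > 1] near 1 the minimum of [K] is attained at [tau]: elsewhere [K w] would be at least
    [z K w]. The recursion at [tau], where [K = 1], then gives [1 >= z + D], that is
    [G(z)/q_tau(z) >= 1]. Letting [z] tend to 1 gives [G(1) q_tau(1) >= q_tau(1)^2 > 0]. *)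
Lemma Gpoly_adj_col_gt0 : 0 < (Gpoly P kc).[1] * (q tau).[1].
Proof.
have [dl dl0 H] := eigen_ratio_near1.
have key z : 1 < z -> z <= 1 + dl -> 0 <= (Gpoly P kc * q tau - q tau ^+ 2).[z].
  move=> z1 zd; have [qt K0] := H z (ltW z1) zd.
  have z0 : 0 < z := lt_trans ltr01 z1.
  set K := eigen_ratio z in K0.
  case: (@arg_minP _ _ _ tau (fun w => admissible_word P w) K taua) => w wa wmin.
  have Pmin (v : n.-tuple S) : admissible_word P v -> K w <= \sum_a P (last a0 v) a * K (next_word v a).
    move=> va; rewrite -[leLHS]mul1r -(P1 (last a0 v)) mulr_suml; apply: ler_sum => a _.
    have := P0 (last a0 v) a; rewrite le_eqVlt => /orP[/eqP <-|pa]; first by rewrite !mul0r.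
    by rewrite ler_wpM2l //; apply: wmin; exact: next_word_admissible pa.
  have zk (v : n.-tuple S) : admissible_word P v -> z <= z ^+ kc v.
    by move=> /kc_pos kv; rewrite -[leLHS]expr1 ler_weXn2l // ltW.
  have wt : w = tau.
    apply/eqP/negP => /negP wt; have := eigen_ratio_rec qt wa.
    rewrite (negPf wt) addr0 -/K => E.
    have : z * K w <= K w.
      rewrite {2}E; apply: ler_pM; rewrite ?zk ?Pmin ?(ltW z0) // ltW //; exact: K0.
    by rewrite leNgt ltr_pMl ?K0 // z1.
  have Kt : K tau = 1 by rewrite /K /eigen_ratio divff.
  have := eigen_ratio_rec qt taua; rewrite eqxx mulr1n -/K Kt => E.
  have h : z * 1 <= z ^+ kc tau * (\sum_a P (last a0 tau) a * K (next_word tau a)).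
    apply: ler_pM; rewrite ?zk ?(ltW z0) //.
    by rewrite -Kt -[K tau]/(K tau) -{1}wt Pmin.
  have {E h} : z - 1 <= (z - 1) * ((Gpoly P kc).[z] / (q tau).[z]).
    rewrite (_ : _ * _ = - ((1 - z) * (Gpoly P kc).[z] / (q tau).[z])); last by ring.
    by lra.
  rewrite -{1}[z - 1]mulr1 ler_pM2l ?subr_gt0 // => h.
  rewrite !hornerE subr_ge0 (_ : (Gpoly P kc).[z] * _ = (Gpoly P kc).[z] / (q tau).[z] * (q tau).[z] ^+ 2).
    by rewrite -[leLHS]mul1r ler_wpM2r // exprn_even_ge0.
  by field.
have q1 := adj_col_tau1_neq0 a0 P0 P1 irr n0 kc_pos taua.
suff : 0 <= (Gpoly P kc * q tau - q tau ^+ 2).[1].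
  rewrite !hornerE subr_ge0; apply: lt_le_trans.
  by rewrite exprn_even_gt0.
rewrite leNgt; apply/negP => neg.
have [|d d0 Hd] := near1_interval (near_horner_gt0 (p := - (Gpoly P kc * q tau - q tau ^+ 2)) _).
  by rewrite hornerN oppr_gt0.
pose z := 1 + Num.min d dl.
have m0 : 0 < Num.min d dl by rewrite lt_min d0.
have zd : z <= 1 + d by rewrite /z lerD2l ge_min lexx.
have zdl : z <= 1 + dl by rewrite /z lerD2l ge_min lexx orbT.
have z1 : 1 < z by rewrite /z ltrDl.
by have := Hd z (ltW z1) zd; rewrite hornerN oppr_gt0 ltNge key.
Qed.

End PositivityNearOne.

(** * Measures of cylinders and of sets that depend on finitely many letters *)

Section CylinderMeasure.
Variables (R : realType) (S : finType) (a0 : S) (P : S -> S -> R) (pi : S -> R).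
Variable mu : {measure set (Tspace S a0) -> \bar R}.
Hypothesis P0 : nonneg_mx P.
Hypothesis pi_stat : stationary_prob P pi.
Hypothesis markov : is_markov_measure P pi mu.

Local Notation T := (Tspace S a0).
Local Notation sq := (nat -> S).

Definition determined_by (N : nat) (B : set sq) :=
  forall y y' : sq, (forall i, (i < N)%N -> y i = y' i) -> B y -> B y'.

Lemma measurable_cyl w : measurable (cyl w : set T).
Proof. by apply: sub_gen_smallest; exists w. Qed.

Lemma cylE w (y : sq) : cyl w y <-> (forall i, (i < size w)%N -> y i = nth a0 w i).
Proof.
by split=> h i iw; [rewrite (h i iw)|rewrite (h i iw)]; exact: set_nth_default.
Qed.

Lemma measurable_determined N (B : set sq) : determined_by N B -> measurable (B : set T).
Proof.
move=> dB.
have -> : B = \bigcup_(v in [set v : N.-tuple S | B (nth a0 v)]) cyl v.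
  apply/seteqP; split=> y /=.
    move=> By; exists [tuple y i | i < N]; last first.
      by apply/cylE => i; rewrite size_tuple => iN; rewrite -(tnth_nth a0 _ (Ordinal iN)) tnth_mktuple.
    by apply: dB By => i iN; rewrite -(tnth_nth a0 _ (Ordinal iN)) tnth_mktuple.
  move=> [v /= Bv /cylE vy]; apply: dB Bv => i iN.
  by rewrite vy // size_tuple.
apply: fin_bigcup_measurable => [|v _]; first exact: finite_finset.
exact: measurable_cyl.
Qed.

Lemma measure_fibers (I : finType) (g : T -> I) (E : set T) : measurable E ->
  (forall a, measurable [set y | g y = a]) ->
  mu E = (\sum_(a : I) mu (E `&` [set y | g y = a]))%E.
Proof.
move=> mE mg.
have H (r : seq I) : uniq r -> measurable [set y | g y \in r] /\
    mu (E `&` [set y | g y \in r]) = (\sum_(a <- r) mu (E `&` [set y | g y = a]))%E.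
  elim: r => [|a r IH] /=.
    rewrite big_nil (_ : [set y | _] = set0) ?setI0 ?measure0 //.
    by apply/seteqP; split.
  move=> /andP[ar /IH[mr hr]].
  have U : [set y | g y \in a :: r] = [set y | g y = a] `|` [set y | g y \in r].
    apply/seteqP; split=> y /=; rewrite inE.
      by case/orP => [/eqP|]; [left|right].
    by case=> [->|->]; rewrite ?eqxx ?orbT.
  rewrite U; have ma := mg a; split; first exact: measurableU.
  rewrite big_cons setIUr measureU.
  - by congr (_ + _)%E; exact: hr.
  - exact: measurableI.
  - exact: measurableI.
  apply/seteqP; split=> y //= -[[_ ya] [_ yr]].
  by rewrite -ya yr in ar.
have [_] := H (enum I) (enum_uniq I); rewrite big_enum /= => <-.
by congr (mu _); apply/seteqP; split=> [y Ey|y [] //]; split=> //=; rewrite mem_enum.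
Qed.

Lemma determined_coord N (a : S) : determined_by N.+1 [set y : sq | y N = a].
Proof. by move=> y y' yy' /= <-; rewrite yy'. Qed.

Lemma cyl_rcons v a : cyl (rcons v a) = cyl v `&` [set y : sq | y (size v) = a].
Proof.
apply/seteqP; split=> y.
  move=> /cylE h; split=> [|/=]; last first.
    by rewrite h ?size_rcons ?leqnn // nth_rcons ltnn eqxx.
  apply/cylE => i iv; rewrite h ?size_rcons 1?ltnW // nth_rcons iv //.
move=> [/cylE h /= hv]; apply/cylE => i; rewrite size_rcons ltnS leq_eqVlt nth_rcons.
by case/orP => [/eqP ->|iv]; rewrite ?ltnn ?eqxx // iv h.
Qed.

Lemma cyl_split v (E : set T) : measurable E ->
  mu (cyl v `&` E) = (\sum_(a : S) mu (cyl (rcons v a) `&` E))%E.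
Proof.
move=> mE; have mv := measurable_cyl v.
rewrite (@measure_fibers _ (fun y : T => (y : sq) (size v))) //.
- by apply: eq_bigr => a _; rewrite cyl_rcons setIAC.
- exact: measurableI.
- by move=> a; apply: (measurable_determined (N := (size v).+1)); exact: determined_coord.
Qed.

(** [is_markov_measure] speaks of nonempty words only, so the total mass is summed over the first
    letter. *)
Lemma mu_setT : mu setT = 1%E.
Proof.
have -> : setT = cyl [::] `&` (setT : set T).
  by rewrite setIT; apply/seteqP; split=> // y _ i.
rewrite cyl_split //; have [_ [<- _]] := pi_stat.
rewrite -sumEFin; apply: eq_bigr => a _.
by rewrite setIT markov //= big_nil mulr1.
Qed.

Lemma mu_fin (A : set T) : measurable A -> mu A \is a fin_num.
Proof.
move=> mA; rewrite ge0_fin_numE ?measure_ge0 //.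
apply: (@le_lt_trans _ _ (mu setT)); last by rewrite mu_setT ltry.
by apply: le_measure; rewrite ?inE.
Qed.

Definition mass (A : set sq) : R := fine (mu (A : set T)).

Lemma massE (A : set T) : measurable A -> mu A = (mass A)%:E.
Proof. by move=> mA; rewrite /mass fineK // mu_fin. Qed.

Lemma mass_ge0 (A : set T) : 0 <= mass A.
Proof. by rewrite /mass fine_ge0. Qed.

Lemma le_mass (A B : set T) : measurable A -> measurable B -> A `<=` B -> mass A <= mass B.
Proof.
move=> mA mB AB; rewrite -lee_fin -!massE //; apply: le_measure; rewrite ?inE //.
Qed.

Lemma mass_cyl w : (0 < size w)%N -> mass (cyl w) = markov_cyl_value P pi w.
Proof. by move=> w0; rewrite /mass markov. Qed.

Lemma mass_cyl_split v (E : set T) : measurable E ->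
  mass (cyl v `&` E) = \sum_(a : S) mass (cyl (rcons v a) `&` E).
Proof.
move=> mE; apply: EFin_inj; rewrite -sumEFin -massE; last exact: measurableI (measurable_cyl v) mE.
rewrite cyl_split //; apply: eq_bigr => a _.
by rewrite massE //; exact: measurableI (measurable_cyl _) mE.
Qed.

Lemma mass_cyl_rcons v a : (0 < size v)%N ->
  mass (cyl (rcons v a)) = mass (cyl v) * P (last a0 v) a.
Proof.
move=> v0; rewrite !mass_cyl ?size_rcons //.
case: v v0 => // b v _ /=; rewrite -mulrA; congr (_ * _).
elim: v b => [|c v IH] b /=; first by rewrite !big_cons !big_nil /= mul1r mulr1.
by rewrite !big_cons /= IH mulrA.
Qed.

Lemma mass_split_prefix N (E : set T) : measurable E ->
  mass E = \sum_(v : N.-tuple S) mass (cyl v `&` E).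
Proof.
move=> mE; apply: EFin_inj; rewrite -sumEFin -massE //.
have fib (v : N.-tuple S) : [set y : T | [tuple (y : sq) i | i < N] = v] = cyl v.
  apply/seteqP; split=> y /=.
    by move=> <-; apply/cylE => i; rewrite size_tuple => iN; rewrite -(tnth_nth a0 _ (Ordinal iN)) tnth_mktuple.
  move=> /cylE h; apply/eq_from_tnth => i; rewrite tnth_mktuple (tnth_nth a0) h // size_tuple.
  exact: ltn_ord.
rewrite (@measure_fibers _ (fun y : T => [tuple (y : sq) i | i < N])) //.
  by apply: eq_bigr => v _; rewrite fib setIC massE //; exact: measurableI (measurable_cyl _) mE.
by move=> v; rewrite fib; exact: measurable_cyl.
Qed.

Lemma mass_cyl_gt0 w : (0 < size w)%N -> admissible_word P w -> 0 < mass (cyl w).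
Proof.
move=> w0; rewrite mass_cyl // /admissible_word; case: w w0 => // a w _ adm.
have [pi0 _] := pi_stat; rewrite /markov_cyl_value mulr_gt0 //.
by rewrite big_seq prodr_gt0 // => ab /(allP adm).
Qed.

Lemma mass_cyl_eq0 w : (0 < size w)%N -> ~~ admissible_word P w -> mass (cyl w) = 0.
Proof.
move=> w0; rewrite mass_cyl // => /allPn[ab abw nab].
have Pab : P ab.1 ab.2 = 0 by apply/eqP; rewrite eq_le P0 leNgt nab.
case: w w0 abw => // a w _ abw.
rewrite /markov_cyl_value (big_rem ab) //= Pab mul0r mulr0 //.
Qed.

End CylinderMeasure.

(** * The counter that detects long runs along the periodic point *)

Section RunCounter.
Variables (S : finType) (a0 : S) (n : nat) (kc : n.-tuple S -> nat) (x : nat -> S).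
Local Notation sq := (nat -> S).
Implicit Types (y : sq) (w : n.-tuple S).

Definition wnd y i : n.-tuple S := [tuple shiftn i y j | j < n].
Local Notation tau := (wnd x 0).

(* [c = l.+1] records that the last [n + l] letters are [x 0, ..., x (n + l - 1)]. *)
Definition run_step (c : nat) w (a : S) : nat :=
  if c is l.+1 then (if a == x (n + l) then l.+2 else (w == tau) : nat)
  else (w == tau) : nat.

Fixpoint run y i : nat :=
  if i is i'.+1 then run_step (run y i') (wnd y i) (y (i' + n)%N)
  else (wnd y 0 == tau) : nat.

Lemma nth_wnd y i j : (j < n)%N -> nth a0 (wnd y i) j = y (i + j)%N.
Proof. by move=> jn; rewrite -(tnth_nth a0 _ (Ordinal jn)) tnth_mktuple /shiftn addnC. Qed.

Lemma wnd_eqP y y' i i' : wnd y i = wnd y' i' <->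
  (forall j, (j < n)%N -> y (i + j)%N = y' (i' + j)%N).
Proof.
split=> [E j jn|H]; first by rewrite -!nth_wnd // E.
by apply/eq_from_tnth => j; rewrite !(tnth_nth a0) !nth_wnd // H.
Qed.

Lemma eq_wnd y y' i : (forall j, (j < i + n)%N -> y j = y' j) -> wnd y i = wnd y' i.
Proof. by move=> yy; apply/wnd_eqP => j jn; rewrite yy // ltn_add2l. Qed.

Lemma eq_run y y' i : (forall j, (j < i + n)%N -> y j = y' j) -> run y i = run y' i.
Proof.
elim: i => [|i IH] yy /=; first by rewrite (eq_wnd yy).
rewrite (eq_wnd yy) IH ?yy ?addSn //.
by move=> j ji; apply: yy; rewrite addSn ltnW.
Qed.

Lemma eq_Sn y y' i : (forall j, (j < i + n)%N -> y j = y' j) ->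
  Sn (ceil_of kc) y i = Sn (ceil_of kc) y' i.
Proof.
move=> yy; apply: eq_bigr => j _; rewrite /ceil_of -/(wnd y j) -/(wnd y' j).
congr kc; apply: eq_wnd => l lj; apply: yy; apply: leq_trans lj _.
by rewrite leq_add2r ltnW.
Qed.

Lemma SnS y i : Sn (ceil_of kc) y i.+1 = (Sn (ceil_of kc) y i + kc (wnd y i))%N.
Proof. by rewrite /Sn big_ord_recr. Qed.

Lemma leq_Sn y i j : (i <= j)%N -> (Sn (ceil_of kc) y i <= Sn (ceil_of kc) y j)%N.
Proof.
move=> /subnK <-; elim: (j - i)%N => [|k IH]; first by rewrite add0n.
by rewrite addSn SnS; exact: leq_trans IH (leq_addr _ _).
Qed.

Lemma wndS y i : (0 < n)%N -> wnd y i.+1 = next_word (wnd y i) (y (i + n)%N).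
Proof.
move=> n0; apply/eq_from_tnth => j; rewrite !(tnth_nth a0) nth_wnd //.
have -> : nth a0 (next_word (wnd y i) (y (i + n)%N)) j
    = nth a0 (rcons (wnd y i) (y (i + n)%N)) j.+1 by rewrite -nth_behead.
rewrite nth_rcons size_tuple.
have jn := ltn_ord j; case: (ltnP j.+1 n) => h; first by rewrite nth_wnd // addSnnS.
have -> : j.+1 = n by apply/eqP; rewrite eqn_leq jn h.
by rewrite eqxx; congr (y _); lia.
Qed.

Lemma last_wnd y i : (0 < n)%N -> last a0 (wnd y i) = y (i + n).-1.
Proof.
move=> n0; rewrite -nth_last size_tuple nth_wnd ?prednK //.
by congr (y _); lia.
Qed.

Lemma run_match y i l : run y i = l.+1 ->
  exists2 i0, (i0 + l = i)%N & forall j, (j < n + l)%N -> y (i0 + j)%N = x j.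
Proof.
have tau_match k : wnd y k == tau -> forall j, (j < n + 0)%N -> y (k + j)%N = x j.
  by rewrite addn0 => /eqP/wnd_eqP h j jn; rewrite h.
elim: i l => [|i IH] l /=.
  case: eqP => //= /eqP wt [<-]; exists 0%N => //; exact (tau_match 0%N wt).
have base : ((wnd y i.+1 == tau) : nat) = l.+1 -> exists2 i0, (i0 + l = i.+1)%N &
    forall j, (j < n + l)%N -> y (i0 + j)%N = x j.
  case: eqP => //= /eqP wt [<-]; exists i.+1; first by rewrite addn0.
  exact (tau_match _ wt).
rewrite /run_step; case E : (run y i) => [|l'] //; case: eqP => // ya [<-].
have [i0 i0l h] := IH l' E; exists i0; first by rewrite addnS i0l.
move=> j; rewrite addnS ltnS leq_eqVlt => /orP[/eqP ->|]; last exact: h.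
by rewrite -ya -i0l; congr (y _); lia.
Qed.

Lemma run_eq0 y i : run y i = 0%N -> wnd y i != tau.
Proof.
case: i => [|i] /=; first by case: eqP.
rewrite /run_step; case: (run y i) => [|l]; first by case: eqP.
by case: eqP => // _; case: eqP.
Qed.

Lemma run_wnd y i l : run y i = l.+1 -> wnd y i = wnd x l.
Proof.
move=> /run_match[i0 <- h]; apply/wnd_eqP => j jn.
by rewrite -addnA h // addnC ltn_add2r.
Qed.

Lemma runS_le y i : (run y i.+1 <= (run y i).+1)%N.
Proof.
rewrite /= /run_step; case: (run y i) => [|l]; first by case: eqP.
by case: eqP => // _; case: eqP.
Qed.

Lemma run0_le1 y : (run y 0 <= 1)%N.
Proof. by rewrite /=; case: eqP. Qed.

Variable p : nat.
Hypotheses (p0 : (0 < p)%N) (pn : (p %| n)%N) (n0 : (0 < n)%N) (xp : shiftn p x = x).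

Lemma periodic_add k j : x (j + k * p)%N = x j.
Proof.
elim: k => [|k IH]; first by rewrite mul0n addn0.
by rewrite mulSn addnCA addnC; have := congr1 (fun f => f (j + k * p)%N) xp; rewrite /shiftn IH.
Qed.

Lemma periodic_mod j : x j = x (j %% p)%N.
Proof. by rewrite {1}(divn_eq j p) addnC periodic_add. Qed.

(** As [n >= p], a window equal to [tau] fixes a whole period. *)
Lemma wnd_tau_shift l : wnd x l = tau -> forall j, x (l + j)%N = x j.
Proof.
move=> /wnd_eqP h j; have pln : (p <= n)%N by apply: dvdn_leq.
have jp := ltn_pmod j p0.
have := h _ (leq_trans jp pln); rewrite add0n -periodic_mod => <-.
by rewrite {1}(divn_eq j p) addnCA addnC periodic_add.
Qed.

(** The counter follows only one run at a time. If an older run is active when [tau] reappears, then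
    by [wnd_tau_shift] both runs predict the same letters, so following the older one misses
    nothing. *)
Lemma run_detect y i M : (forall j, (j < n + M)%N -> y (i + j)%N = x j) ->
  (M < run y (i + M))%N.
Proof.
move=> h.
have wt : wnd y i = tau by apply/wnd_eqP => j jn; rewrite h // ltn_addr.
case E : (run y i) => [|l]; first by have := run_eq0 E; rewrite wt eqxx.
have xl := wnd_tau_shift (etrans (esym (run_wnd E)) wt).
have H k : (k <= M)%N -> run y (i + k) = (l + k).+1.
  elim: k => [|k IH] kM; first by rewrite !addn0.
  rewrite addnS /= IH ?(ltnW kM) // /run_step.
  have -> : y (i + k + n)%N = x (n + (l + k))%N.
    rewrite -addnA h; last by rewrite addnC ltn_add2l.
    by rewrite addnCA xl addnC.
  by rewrite eqxx addnS.
by rewrite H // ltnS leq_addl.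
Qed.

End RunCounter.

(** The lower bound [b.1] concerns positive values only, since weights of states that never occur
    may have any sign. *)
Lemma finite_pos_bounds (R : realType) (I : finType) (F : I -> R) :
  exists2 b : R * R, 0 < b.1 /\ 0 < b.2 & forall i, F i <= b.2 /\ (0 < F i -> b.1 <= F i).
Proof.
have H (r : seq I) : exists2 m : R, 0 < m & forall i, i \in r -> 0 < F i -> m <= F i.
  elim: r => [|i r [m m0 IH]]; first by exists 1.
  have [Fi|Fi] := ltP 0 (F i); last first.
    exists m => // j; rewrite inE => /orP[/eqP ->|/IH //]; by rewrite ltNge Fi.
  exists (Num.min m (F i)); first by rewrite lt_min m0.
  move=> j; rewrite inE => /orP[/eqP -> _|jr /IH]; first by rewrite ge_min lexx orbT.
  by move=> /(_ jr); apply: le_trans; rewrite ge_min lexx.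
have [m m0 hm] := H (enum I).
exists (m, 1 + \sum_i `|F i|); split=> //=.
- by rewrite ltr_pwDl // sumr_ge0.
- rewrite (bigD1 i) //= addrA (addrC 1) -addrA; apply: ler_wpDr; last exact: ler_norm.
  by rewrite addr_ge0 // sumr_ge0.
- by apply: hm; rewrite mem_enum.
Qed.

(** * Admissible windows of finite and infinite words *)

Section AdmissibleWindows.
Variables (R : realType) (S : finType) (a0 : S) (P : S -> S -> R) (n : nat).
Hypothesis n0 : (0 < n)%N.

(** Transitions are controlled only below [N], so that the lemma also serves finite words read
    through [nth a0], where padding starts at the end of the word. *)
Lemma admissible_wnd (y : nat -> S) N i : (forall k, (k.+1 < N)%N -> 0 < P (y k) (y k.+1)) ->
  (i + n <= N)%N -> admissible_word P (wnd n y i).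
Proof.
move=> hy iN; rewrite admissible_wordE; apply/(sortedP a0) => j.
rewrite size_tuple => jn; rewrite !(nth_wnd a0) //; last exact: ltnW.
by rewrite addnS; apply: hy; lia.
Qed.

Lemma leq_index_Sn (kc : n.-tuple S -> nat) (y : nat -> S) N i :
  (forall w : n.-tuple S, admissible_word P w -> (1 <= kc w)%N) -> (forall k, (k.+1 < N)%N -> 0 < P (y k) (y k.+1)) ->
  (i + n <= N.+1)%N -> (i <= Sn (ceil_of kc) y i)%N.
Proof.
move=> kc_pos hy; elim: i => [//|i IH] iN; rewrite SnS -addn1.
apply: leq_add; first by apply: IH; lia.
by apply: kc_pos; apply: (admissible_wnd hy); lia.
Qed.

End AdmissibleWindows.

(** * Mass of the points that avoid a long run up to time t *)

Section SurvivalMass.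
Variables (R : realType) (S : finType) (a0 : S) (P : S -> S -> R) (pi : S -> R).
Variable mu : {measure set (Tspace S a0) -> \bar R}.
Hypothesis P0 : nonneg_mx P.
Hypothesis P1 : row_stochastic P.
Hypothesis pi_stat : stationary_prob P pi.
Hypothesis markov : is_markov_measure P pi mu.
Variables (n : nat) (kc : n.-tuple S -> nat) (x : nat -> S) (M : nat).
Hypothesis n0 : (0 < n)%N.
Hypothesis kc_pos : forall w : n.-tuple S, admissible_word P w -> (1 <= kc w)%N.
Hypothesis M0 : (0 < M)%N.
Hypothesis xSigma : in_SigmaP P x.

Local Notation sq := (nat -> S).
Local Notation wnd := (@wnd S n).
Local Notation run := (@run S n x).
Local Notation Snk := (Sn (ceil_of kc)).
Local Notation tau := (wnd x 0).
Local Notation mass := (mass mu).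

(* The counter is tested one step ahead, so that a word completing the run has no mass left
   even if its own level exceeds [t]. *)
Definition no_run (t : nat) : set sq :=
  [set y | forall i, (i <= t)%N -> (Snk y i <= t)%N -> (run y i.+1 <= M)%N].

Lemma no_run_determined t : determined_by (t.+1 + n) (no_run t).
Proof.
move=> y y' yy' h i it St.
rewrite -(@eq_run _ a0 _ x y) ?h //; last first.
  by move=> j ji; apply: yy'; apply: leq_trans ji _; rewrite leq_add2r ltnS.
rewrite (@eq_Sn _ a0 _ kc y y') // => j ji; apply: yy'.
by apply: leq_trans ji _; rewrite leq_add2r ltnW.
Qed.

Lemma measurable_no_run t : measurable (no_run t : set (Tspace S a0)).
Proof.
apply: (measurable_determined (a0 := a0) (N := t.+1 + n)); exact: no_run_determined.
Qed.

Variables (z D : R) (K : n.-tuple S -> R) (d : nat -> R).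
Hypothesis z1 : 1 <= z.
Hypothesis K_pos : forall w : n.-tuple S, admissible_word P w -> 0 < K w.
Hypothesis K_rec : forall w : n.-tuple S, admissible_word P w ->
  K w = z ^+ kc w * (\sum_a P (last a0 w) a * K (next_word w a)) + D *+ (w == tau).
Hypothesis d0 : d 0 = 0.
Hypothesis d_rec : forall l, (l < M)%N ->
  d l = z ^+ kc (wnd x l) * P (x (l + n).-1) (x (l + n)%N) * d l.+1 - D *+ (wnd x l == tau).
Hypothesis K_dead : K (wnd x M) + d M = 0.
Hypothesis K_live : forall l, (l < M)%N -> 0 < K (wnd x l) + d l.

Definition run_weight (w : n.-tuple S) (c : nat) : R :=
  K w + (if c is l.+1 then d l else 0).

(** The role of [d 0 = 0]: a run that has just started weighs the same as no run. *)
Lemma run_weight_tau w (b : bool) : run_weight w b = K w.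
Proof. by case: b; rewrite /run_weight /= ?d0 addr0. Qed.

(** The defect [D] of [K] at [tau] cancels the one in [d_rec]. Only the letter that continues the
    run carries an offset; any other letter resets the counter to 0 or 1. *)
Lemma run_weight_rec (y : sq) i : admissible_word P (wnd y i) -> (run y i <= M)%N ->
  run_weight (wnd y i) (run y i) = z ^+ kc (wnd y i) *
    \sum_a P (last a0 (wnd y i)) a * run_weight (next_word (wnd y i) a)
              (run_step x (run y i) (next_word (wnd y i) a) a).
Proof.
move=> wa; case E : (run y i) => [|l] lM.
  under eq_bigr => a _ do rewrite run_weight_tau.
  by rewrite /run_weight addr0 K_rec // (negPf (run_eq0 E)) addr0.
rewrite /run_weight K_rec // d_rec // -(run_wnd a0 E) addrCA addrK addrC.
have -> : P (x (l + n).-1) (x (l + n)%N) = P (last a0 (wnd y i)) (x (n + l)%N).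
  by rewrite (run_wnd a0 E) last_wnd // addnC.
rewrite -mulrA -mulrDr; congr (_ * _).
rewrite (bigD1 (x (n + l)%N)) //= [RHS](bigD1 (x (n + l)%N)) //= eqxx mulrDr -!addrA.
rewrite [X in _ + X]addrC; congr (_ + _); congr (_ + _).
apply: eq_bigr => a /negPf ax; congr (_ * _); rewrite ax.
by case: (_ == _); rewrite /= ?d0 addr0.
Qed.

Lemma run_weight_gt0 (y : sq) i : admissible_word P (wnd y i) -> (run y i <= M)%N ->
  0 < run_weight (wnd y i) (run y i).
Proof.
move=> wa; rewrite /run_weight; case E : (run y i) => [|l] lM.
  by rewrite addr0 K_pos.
by rewrite (run_wnd a0 E); exact: K_live.
Qed.

Lemma run_weight_dead (y : sq) i : run y i = M.+1 -> run_weight (wnd y i) (run y i) = 0.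
Proof. by move=> E; rewrite E /run_weight (run_wnd a0 E) K_dead. Qed.

Section CylinderInduction.
Variables (t : nat) (hmin hmax : R).
Hypotheses (hmin0 : 0 < hmin) (hmax0 : 0 < hmax).
Hypothesis hbounds : forall w c, (c <= M)%N ->
  run_weight w c <= hmax /\ (0 < run_weight w c -> hmin <= run_weight w c).

Let cl := (z ^+ Kmax kc * hmax)^-1.
Let cu := hmin^-1.

(** Weighted mass of a cylinder; by [run_weight_rec] it is additive when the cylinder is split by
    the next letter. *)
Let W v i := z ^+ Snk (nth a0 v) i *
  (mass (cyl v) * run_weight (wnd (nth a0 v) i) (run (nth a0 v) i)).

(** Once the ceiling sum exceeds [t], nothing remains to be tested on the cylinder. The sum exceeds
    [t] by at most [Kmax kc] and the weight lies between [hmin] and [hmax], which gives the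
    constants [cl] and [cu]. *)
Lemma cylinder_base v i : size v = (i + n)%N ->
  (forall k, (k.+1 < size v)%N -> 0 < P (nth a0 v k) (nth a0 v k.+1)) ->
  (forall j, (j <= i)%N -> (run (nth a0 v) j <= M)%N) ->
  (t < Snk (nth a0 v) i)%N -> (Snk (nth a0 v) i <= t + Kmax kc)%N ->
  cl * W v i <= z ^+ t * mass (cyl v `&` no_run t) <= cu * W v i.
Proof.
move=> sv adm live ti it.
have -> : cyl v `&` no_run t = cyl v.
  apply/seteqP; split=> [y []//|y vy]; split=> // j jt Sj.
  have yv k : (k < i + n)%N -> y k = nth a0 v k.
    by move=> ki; move/(cylE a0): vy; apply; rewrite sv.
  have ji : (j < i)%N.
    rewrite ltnNge; apply/negP => ij.
    have := leq_Sn kc y ij; rewrite (eq_Sn a0 kc yv) => h.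
    by have := leq_trans ti (leq_trans h Sj); rewrite ltnn.
  rewrite (@eq_run _ a0 _ x y (nth a0 v)) ?live // => k kj; apply: yv.
  by apply: leq_trans kj _; rewrite leq_add2r.
have wa : admissible_word P (wnd (nth a0 v) i).
  by apply: (admissible_wnd a0 n0 adm); rewrite sv.
have hpos := run_weight_gt0 wa (live i (leqnn i)).
have [hM hm] := hbounds (wnd (nth a0 v) i) (live i (leqnn i)).
have {}hm := hm hpos.
set h := run_weight _ _ in hpos hM hm.
have z0 : 0 < z by apply: lt_le_trans z1.
have m0 : 0 <= mass (cyl v) by exact: mass_ge0.
rewrite /W -/h /cl /cu; apply/andP; split.
  rewrite mulrC ler_pdivrMr ?mulr_gt0 ?exprn_gt0 //.
  apply: le_trans (_ : z ^+ (t + Kmax kc) * (mass (cyl v) * hmax) <= _); last first.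
    by rewrite exprD le_eqVlt; apply/orP; left; apply/eqP; ring.
  apply: ler_pM; rewrite ?exprn_ge0 ?mulr_ge0 ?(ltW z0) ?(ltW hpos) //.
    by rewrite ler_weXn2l.
  by rewrite ler_wpM2l.
rewrite ler_pdivlMl // mulrCA (mulrC hmin).
apply: ler_pM; rewrite ?exprn_ge0 ?mulr_ge0 ?(ltW z0) ?(ltW hmin0) //.
  by rewrite ler_weXn2l // ltnW.
by rewrite ler_wpM2l.
Qed.

(** Split by the next letter until the ceiling sum passes [t]. Both sides are additive, so the
    constants do not deteriorate; [r] bounds the time left, and each letter uses at least one unit
    by [kc_pos]. *)
Lemma cylinder_bounds r v i : size v = (i + n)%N ->
  (forall k, (k.+1 < size v)%N -> 0 < P (nth a0 v k) (nth a0 v k.+1)) ->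
  (forall j, (j <= i)%N -> (run (nth a0 v) j <= M)%N) ->
  (t < Snk (nth a0 v) i + r)%N -> (Snk (nth a0 v) i <= t + Kmax kc)%N ->
  cl * W v i <= z ^+ t * mass (cyl v `&` no_run t) <= cu * W v i.
Proof.
elim: r v i => [|r IH] v i sv adm live tr it.
  by apply: cylinder_base => //; rewrite addn0 in tr.
have [ti|ti] := ltnP t (Snk (nth a0 v) i); first exact: cylinder_base.
have i_t : (i <= t)%N by apply: leq_trans ti; apply: (leq_index_Sn a0 n0 kc_pos adm); rewrite sv.
have z0 : 0 < z by apply: lt_le_trans z1.
have wa : admissible_word P (wnd (nth a0 v) i).
  by apply: (admissible_wnd a0 n0 adm); rewrite sv.
have v0 : (0 < size v)%N by rewrite sv addn_gt0 n0 orbT.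
have agree a j : (j < i + n)%N -> nth a0 (rcons v a) j = nth a0 v j.
  by rewrite -sv nth_rcons => ->.
have wnd_child a : wnd (nth a0 (rcons v a)) i.+1 = next_word (wnd (nth a0 v) i) a.
  rewrite (wndS a0) // (@eq_wnd _ a0 _ _ (nth a0 v) i (agree a)).
  by rewrite nth_rcons sv ltnn eqxx.
have run_child a : run (nth a0 (rcons v a)) i.+1
    = run_step x (run (nth a0 v) i) (next_word (wnd (nth a0 v) i) a) a.
  rewrite -wnd_child /= (@eq_run _ a0 _ x _ (nth a0 v) i (agree a)).
  by rewrite [nth a0 (rcons v a) (i + n)]nth_rcons sv ltnn eqxx.
have Sn_child a : Snk (nth a0 (rcons v a)) i.+1 = (Snk (nth a0 v) i + kc (wnd (nth a0 v) i))%N.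
  by rewrite SnS (@eq_Sn _ a0 _ kc _ (nth a0 v) i (agree a)) (@eq_wnd _ a0 _ _ (nth a0 v) i (agree a)).
have last_v : last a0 v = last a0 (wnd (nth a0 v) i).
  by rewrite last_wnd // -nth_last sv.
have WE : W v i = \sum_a W (rcons v a) i.+1.
  rewrite /W (run_weight_rec wa (live i (leqnn i))) mulrCA !mulrA mulr_sumr.
  apply: eq_bigr => a _.
  rewrite Sn_child wnd_child run_child (mass_cyl_rcons markov) // exprD -last_v; ring.
have child a : cl * W (rcons v a) i.+1 <= z ^+ t * mass (cyl (rcons v a) `&` no_run t)
    <= cu * W (rcons v a) i.+1.
  have mcr : measurable (cyl (rcons v a) `&` no_run t : set (Tspace S a0)).
    by apply: measurableI; [exact: measurable_cyl|exact: measurable_no_run].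
  have := P0 (last a0 v) a; rewrite le_eqVlt => /orP[/eqP Pa|Pa].
    have m0 : mass (cyl (rcons v a)) = 0 by rewrite (mass_cyl_rcons markov) // -Pa mulr0.
    have -> : mass (cyl (rcons v a) `&` no_run t) = 0.
      apply/eqP; rewrite eq_le mass_ge0 andbT -m0.
      by apply: (le_mass pi_stat markov) => //; exact: measurable_cyl.
    by rewrite /W m0 !(mulr0, mul0r) lexx.
  have adm' k : (k.+1 < size (rcons v a))%N ->
      0 < P (nth a0 (rcons v a) k) (nth a0 (rcons v a) k.+1).
    rewrite size_rcons ltnS leq_eqVlt => /orP[/eqP kv|kv].
      rewrite !nth_rcons kv ltnn eqxx -kv ltnSn.
      by rewrite -nth_last -kv /= in Pa.
    by rewrite !nth_rcons kv ltnW // adm.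
  (* A child that completes the run has weight 0 and does not meet [no_run]. The latter uses the
     test one step ahead, as the ceiling sum at index [i] is still at most [t]. *)
  have [dead|live'] := ltnP M (run (nth a0 (rcons v a)) i.+1).
    have rE : run (nth a0 (rcons v a)) i.+1 = M.+1.
      apply/eqP; rewrite eqn_leq dead andbT; apply: leq_trans (runS_le _ _ _ _) _.
      by rewrite ltnS (@eq_run _ a0 _ x _ (nth a0 v) i (agree a)) live.
    have -> : cyl (rcons v a) `&` no_run t = set0.
      apply/seteqP; split=> // y [/(cylE a0) ya].
      have yv k : (k < i.+1 + n)%N -> y k = nth a0 (rcons v a) k.
        by move=> ki; apply: ya; rewrite size_rcons sv.
      move=> /(_ i i_t); rewrite (@eq_Sn _ a0 _ kc y (nth a0 v)); last first.
        by move=> k ki; rewrite yv ?agree // addSn ltnW.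
      by move=> /(_ ti); rewrite (@eq_run _ a0 _ x y _ _ yv) leqNgt dead.
    by rewrite /W (run_weight_dead rE) /mass measure0 /= !mulr0 lexx.
  apply: IH => //.
  - by rewrite size_rcons sv.
  - move=> j; rewrite leq_eqVlt => /orP[/eqP -> //|ji].
    rewrite (@eq_run _ a0 _ x _ (nth a0 v)) ?live // => k kj; apply: agree.
    by apply: leq_trans kj _; rewrite leq_add2r.
  - by rewrite Sn_child; have := kc_pos wa; lia.
  - by rewrite Sn_child leq_add // ltnW // kc_lt_Kmax.
rewrite WE (mass_cyl_split pi_stat markov _ (measurable_no_run t)) !mulr_sumr.
by apply/andP; split; apply: ler_sum => a _; have /andP[] := child a.
Qed.

End CylinderInduction.

Lemma no_run_mass : exists2 c : R * R, 0 < c.1 /\ 0 < c.2 &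
  forall t, c.1 <= z ^+ t * mass (no_run t) <= c.2.
Proof.
have [[hmin hmax] [/= hmin0 hmax0] hb] :=
  @finite_pos_bounds R _ (fun wc : n.-tuple S * 'I_M.+1 => run_weight wc.1 wc.2).
have hbounds w c : (c <= M)%N ->
    run_weight w c <= hmax /\ (0 < run_weight w c -> hmin <= run_weight w c).
  by move=> cM; exact: (hb (w, Ordinal (cM : (c < M.+1)%N))).
have z0 : 0 < z by apply: lt_le_trans z1.
pose cl := (z ^+ Kmax kc * hmax)^-1; pose cu := hmin^-1.
have cl0 : 0 < cl by rewrite invr_gt0 mulr_gt0 ?exprn_gt0.
have cu0 : 0 < cu by rewrite invr_gt0.
have taua : admissible_word P tau by apply: (@admissible_wnd _ _ a0 _ _ n0 x n) => // k _; exact: xSigma.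
have mt0 : 0 < mass (cyl tau) by apply: (mass_cyl_gt0 pi_stat markov); rewrite ?size_tuple.
exists (cl * (mass (cyl tau) * hmin), cu * hmax).
  by split; rewrite /= !mulr_gt0.
move=> t.
have key (v : n.-tuple S) : admissible_word P v ->
    cl * (mass (cyl v) * hmin) <= z ^+ t * mass (cyl v `&` no_run t) <= cu * (mass (cyl v) * hmax).
  move=> va.
  have adm k : (k.+1 < size v)%N -> 0 < P (nth a0 v k) (nth a0 v k.+1).
    by move: va; rewrite admissible_wordE => /(sortedP a0) h /h.
  have live : (run (nth a0 v) 0 <= M)%N by apply: leq_trans (run0_le1 _ _ _) M0.
  (* The ceiling sum starts at 0, so [t.+1] steps suffice. *)
  have := @cylinder_bounds t hmin hmax hmin0 hmax0 hbounds t.+1 v 0.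
  rewrite {1}/Sn {1}big_ord0 add0n ltnSn {1}/Sn {1}big_ord0 size_tuple.
  case/(_ erefl)/(_ _)/(_ _)/(_ isT)/(_ isT)/andP.
  - by move=> k kn; apply: adm; rewrite size_tuple.
  - by move=> j; rewrite leqn0 => /eqP ->.
  rewrite /Sn big_ord0 expr0 mul1r -/cl -/cu => lo hi.
  have wa : admissible_word P (wnd (nth a0 v) 0).
    by apply: (@admissible_wnd _ _ a0 _ _ n0 _ n) => // k kn; apply: adm; rewrite size_tuple.
  have hpos := run_weight_gt0 wa live.
  have [hM hm] := hbounds (wnd (nth a0 v) 0) _ live; have {}hm := hm hpos.
  apply/andP; split.
    by apply: le_trans lo; rewrite ler_wpM2l ?(ltW cl0) // ler_wpM2l ?mass_ge0.
  by apply: le_trans hi _; rewrite ler_wpM2l ?(ltW cu0) // ler_wpM2l ?mass_ge0.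
rewrite (mass_split_prefix pi_stat markov n (measurable_no_run t)) mulr_sumr.
have mE (v : n.-tuple S) : measurable (cyl v `&` no_run t : set (Tspace S a0)).
  by apply: measurableI; [exact: measurable_cyl|exact: measurable_no_run].
apply/andP; split.
  rewrite (bigD1 tau) //=; apply: ler_wpDr; last by have /andP[] := key tau taua.
  by apply: sumr_ge0 => v _; rewrite mulr_ge0 ?exprn_ge0 ?(ltW z0) // mass_ge0.
apply: le_trans (_ : \sum_(v : n.-tuple S) cu * (mass (cyl v) * hmax) <= _).
  apply: ler_sum => v _; have [va|va] := boolP (admissible_word P v).
    by have /andP[] := key v va.
  have m0 : mass (cyl v) = 0 by apply: (mass_cyl_eq0 P0 markov); rewrite ?size_tuple.
  rewrite m0 mul0r mulr0 (_ : mass _ = 0) ?mulr0 //.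
  apply/eqP; rewrite eq_le mass_ge0 andbT -m0.
  by apply: (le_mass pi_stat markov) => //; exact: measurable_cyl.
rewrite -mulr_sumr -mulr_suml ler_wpM2l ?(ltW cu0) // ler_piMl ?(ltW hmax0) //.
have := mass_split_prefix pi_stat markov n (@measurableT _ (Tspace S a0)).
rewrite {1}/mass (mu_setT pi_stat markov) /= => ->.
by apply: ler_sum => v _; rewrite setIT.
Qed.

End SurvivalMass.

(** * From runs of letters to visits of the flow to the hole *)

Section Sections.
Variables (R : realType) (S : finType) (a0 : S) (P : S -> S -> R).
Variables (n : nat) (kc : n.-tuple S -> nat) (x : nat -> S) (M p : nat).
Hypothesis n0 : (0 < n)%N.
Hypothesis kc_pos : forall w : n.-tuple S, admissible_word P w -> (1 <= kc w)%N.
Hypothesis M0 : (0 < M)%N.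
Hypotheses (p0 : (0 < p)%N) (pn : (p %| n)%N) (xp : shiftn p x = x).

Local Notation sq := (nat -> S).
Local Notation phi := (ceil_of kc).
Local Notation Snk := (Sn phi).
Local Notation A := (cyl (mkseq x (n + M))).

Lemma shiftn0 (y : sq) : shiftn 0 y = y.
Proof. by apply/funext => i; rewrite /shiftn addn0. Qed.

Lemma cyl_shift_mkseq (y : sq) i N :
  cyl (mkseq x N) (shiftn i y) <-> (forall j, (j < N)%N -> y (i + j)%N = x j).
Proof.
split=> [/(cylE a0) h j jN|h].
  by have := h j; rewrite size_mkseq nth_mkseq // /shiftn addnC => /(_ jN).
by apply/(cylE a0) => j; rewrite size_mkseq => jN; rewrite nth_mkseq // /shiftn addnC h.
Qed.

Lemma Sn0 (y : sq) : Snk y 0 = 0%N.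
Proof. by rewrite /Sn big_ord0. Qed.

Lemma Sn1 (y : sq) : Snk y 1 = phi y.
Proof. by rewrite /Sn big_ord1 shiftn0. Qed.

Lemma Sn_add_le (y : sq) i j : (Snk y (i + j) <= Snk y i + j * Kmax kc)%N.
Proof.
elim: j => [|j IH]; first by rewrite addn0 mul0n addn0.
by rewrite addnS SnS mulSn; have := kc_lt_Kmax kc (wnd n y (i + j)); lia.
Qed.

Lemma wnd_Sigma (y : sq) i : in_SigmaP P y -> admissible_word P (wnd n y i).
Proof. by move=> yS; apply: (@admissible_wnd _ _ a0 _ _ n0 y (i + n) i _ (leqnn _)) => k _; exact: yS. Qed.

Lemma Sn_lt (y : sq) i j : in_SigmaP P y -> (i < j)%N -> (Snk y i < Snk y j)%N.
Proof.
move=> yS ij; apply: leq_trans (leq_Sn kc y ij).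
by rewrite SnS -addn1 leq_add2l kc_pos // wnd_Sigma.
Qed.

Lemma leq_Sn_id (y : sq) i : in_SigmaP P y -> (i <= Snk y i)%N.
Proof.
by move=> yS; elim: i => // i IH; apply: leq_ltn_trans IH _; exact: Sn_lt.
Qed.

Definition hit_free (t : nat) : set sq :=
  [set y | forall i, (Snk y i <= t)%N -> ~ A (shiftn i y)].

(** A visit at index [i] completes its run at index [i + M], tested at [i + M - 1]; the slack
    [M * Kmax kc] covers the time in between. *)
Lemma no_run_hit_free (y : sq) t : in_SigmaP P y ->
  no_run kc x M (t + M * Kmax kc) y -> hit_free t y.
Proof.
move=> yS nr i it /cyl_shift_mkseq h.
have := run_detect a0 p0 pn n0 xp h.
have -> : (i + M = (i + M.-1).+1)%N by rewrite -addnS prednK.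
rewrite ltnNge => /negP; apply.
have b : (Snk y (i + M.-1) <= t + M * Kmax kc)%N.
  apply: leq_trans (Sn_add_le _ _ _) _; apply: leq_add => //.
  by rewrite leq_mul2r leq_pred orbT.
by apply: nr => //; apply: leq_trans b; exact: leq_Sn_id.
Qed.

(** A run found at index [i.+1] began at an earlier or equal index, whose ceiling sum exceeds [t] by
    at most one value of the ceiling function. *)
Lemma hit_free_no_run (y : sq) t : hit_free (t + Kmax kc) y -> no_run kc x M t y.
Proof.
move=> hf i _ it; rewrite leqNgt; apply/negP.
case E : (run n x y i.+1) => [//|l]; rewrite ltnS => Ml.
have [i0 i0l h] := run_match a0 E.
apply: (hf i0).
  apply: leq_trans (leq_Sn kc y (_ : (i0 <= i.+1)%N)) _; first by rewrite -i0l leq_addr.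
  by rewrite SnS leq_add // ltnW // kc_lt_Kmax.
apply/cyl_shift_mkseq => j jn; apply: h; apply: leq_trans jn _.
by rewrite leq_add2l.
Qed.

Lemma NtP (y : sq) (u : R) : in_SigmaP P y -> 0 <= u ->
  exists N, Nt phi y u = N.+1 /\ u < (Snk y N.+1)%:R /\ (Snk y N)%:R <= u.
Proof.
move=> yS u0.
pose Q := fun j : nat => u < (Snk y j)%:R.
have exQ : exists j, Q j.
  exists (Num.truncn u).+1; rewrite /Q.
  have /andP[_ h] := truncn_itv u0; apply: lt_le_trans h _.
  by rewrite ler_nat leq_Sn_id.
case: (ex_minnP exQ) => m Qm mmin.
have hset : [set j | u < (Snk y j)%:R /\ forall i, (i < j)%N -> (Snk y i)%:R <= u] m.
  split=> // i im; rewrite leNgt; apply/negP => /mmin; by rewrite leqNgt im.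
have := xgetPex 0%N (ex_intro _ _ hset); rewrite -/(Nt phi y u) => -[h1 h2].
case E : (Nt phi y u) h1 h2 => [|N] h1 h2.
  by move: h1; rewrite Sn0 mulr0n ltNge u0.
by exists N; split=> //; split=> //; apply: h2.
Qed.

(** The flow from [(y, s)] meets the base at [shiftn i y] at time [Snk y i - s], and at time [u] it
    sits over the last such point, so only these discrete times matter. *)
Lemma survivors_section (y : sq) (t s : R) : in_SigmaP P y -> 0 <= t ->
  @survivors R S a0 phi A t (y, s) <->
  [/\ 0 <= s, s < (phi y)%:R & forall i, (Snk y i)%:R <= s + t -> ~ A (shiftn i y)].
Proof.
move=> yS t0; split.
  move=> [/= s0 [sphi h]]; split=> // i it Ai.
  case: i => [|i] in it Ai *.
    apply: (h 0) => //; rewrite /flow /= subr_gt0 sphi /=.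
    by rewrite shiftn0 in Ai.
  have phiS : (phi y)%:R <= (Snk y i.+1)%:R :> R by rewrite ler_nat -Sn1 leq_Sn.
  have tau0 : 0 <= (Snk y i.+1)%:R - s by rewrite subr_ge0 (le_trans (ltW sphi)).
  have taut : (Snk y i.+1)%:R - s <= t by rewrite lerBlDl.
  apply: (h _ tau0 taut); rewrite /flow /= ltrD2r ltNge phiS /= addrC subrK.
  have [N [-> [h1 h2]]] := NtP yS (ler0n R (Snk y i.+1)).
  rewrite ltr_nat in h1; rewrite ler_nat in h2.
  suff -> : N.+1.-1 = i.+1 by [].
  apply/eqP; rewrite /= eqn_leq; apply/andP; split; rewrite leqNgt; apply/negP.
    by move=> /(Sn_lt yS); rewrite ltnNge h2.
  by move=> /(leq_Sn kc y); rewrite leqNgt h1.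
move=> [s0 sphi h]; split=> //; split=> // u u0 ut.
rewrite /flow /=; case: ifPn => [_|/=].
  rewrite /= -[y]shiftn0; apply: h; rewrite Sn0 addr_ge0 //.
rewrite -leNgt => hu.
have su : 0 <= s + u by rewrite addr_ge0.
have [N [-> [_ h2]]] := NtP yS su.
by apply: h => /=; apply: le_trans h2 _; rewrite lerD2l.
Qed.

End Sections.

(** * The escape rate of the flow from the mass of run-free points *)

Section EscapeRate.
Variables (R : realType) (S : finType) (a0 : S) (P : S -> S -> R) (pi : S -> R).
Variable mu : {measure set (Tspace S a0) -> \bar R}.
Hypothesis P0 : nonneg_mx P.
Hypothesis pi_stat : stationary_prob P pi.
Hypothesis markov : is_markov_measure P pi mu.

(** Monotonicity without measurability of [f] and [g], since the length of the section of
    [survivors] is only compared with measurable bounds. *)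
Lemma le_integralT d (T : measurableType d) (m : {measure set T -> \bar R}) (f g : T -> \bar R) :
  (forall y, (0 <= f y)%E) -> (forall y, (f y <= g y)%E) ->
  (\int[m]_y f y <= \int[m]_y g y)%E.
Proof.
move=> f0 fg; have g0 y : (0 <= g y)%E := le_trans (f0 y) (fg y).
rewrite !ge0_integralTE //; apply: le_ereal_sup => _ [h /= hf <-].
by exists h => //= y; exact: le_trans (hf y) (fg y).
Qed.

Definition bad_step i : set (nat -> S) := [set y | ~ 0 < P (y i) (y i.+1)].

Lemma bad_step_determined i : determined_by i.+2 (bad_step i).
Proof. by move=> y y' yy'; rewrite /bad_step /= !yy'. Qed.

Lemma measurable_bad_step i : measurable (bad_step i : set (Tspace S a0)).
Proof. by apply: (measurable_determined (N := i.+2)); exact: bad_step_determined. Qed.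

Lemma bad_stepE : ~` [set y | in_SigmaP P y] = \bigcup_i bad_step i.
Proof.
apply/seteqP; split=> y /=.
  by move=> /existsNP[i h]; exists i.
by move=> [i _ h] yS; apply: h; exact: yS.
Qed.

Lemma measurable_notSigma : measurable (~` [set y | in_SigmaP P y] : set (Tspace S a0)).
Proof. by rewrite bad_stepE; apply: bigcupT_measurable => i; exact: measurable_bad_step. Qed.

Lemma mu_notSigma : mu (~` [set y | in_SigmaP P y] : set (Tspace S a0)) = 0%E.
Proof.
apply/negligibleP; first exact: measurable_notSigma.
rewrite bad_stepE; apply: negligible_bigcup => i.
apply/negligibleP; first exact: measurable_bad_step.
apply: (etrans (massE pi_stat markov (measurable_bad_step i))).
rewrite (mass_split_prefix pi_stat markov i.+2 (measurable_bad_step i)) big1 // => v _.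
have mvb : measurable (cyl v `&` bad_step i : set (Tspace S a0)).
  by apply: measurableI; [exact: measurable_cyl|exact: measurable_bad_step].
have [va|va] := boolP (admissible_word P v); last first.
  apply/eqP; rewrite eq_le mass_ge0 andbT.
  rewrite -(mass_cyl_eq0 P0 markov _ va) ?size_tuple //.
  by apply: (le_mass pi_stat markov) => //; exact: measurable_cyl.
rewrite (_ : _ `&` _ = set0) /mass ?measure0 //.
apply/seteqP; split=> // y [/(cylE a0) yv]; apply.
rewrite !yv ?size_tuple // ?(ltnW (ltnSn _)) //.
by move: va; rewrite admissible_wordE => /(sortedP a0); apply; rewrite size_tuple.
Qed.

Lemma mu_setI_Sigma (B : set (Tspace S a0)) : measurable B ->
  mu (B `&` [set y | in_SigmaP P y]) = mu B.
Proof.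
move=> mB; have mN := measurable_notSigma.
have mS : measurable ([set y | in_SigmaP P y] : set (Tspace S a0)).
  by rewrite -[X in measurable X]setCK; exact: measurableC.
have z0 : mu (B `&` ~` [set y | in_SigmaP P y]) = 0%E.
  apply/eqP; rewrite eq_le measure_ge0 andbT -mu_notSigma.
  by apply: le_measure; rewrite ?inE //; exact: measurableI.
have U : mu ((B `&` [set y | in_SigmaP P y]) `|` (B `&` ~` [set y | in_SigmaP P y]))
    = (mu (B `&` [set y | in_SigmaP P y]) + mu (B `&` ~` [set y | in_SigmaP P y]))%E.
  apply: measureU; [exact: measurableI|exact: measurableI|].
  by rewrite setIACA setICr setI0.
by rewrite -setIUr setUv setIT z0 adde0 in U.
Qed.

Variables (n : nat) (kc : n.-tuple S -> nat) (x : nat -> S) (M p : nat).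
Hypothesis n0 : (0 < n)%N.
Hypothesis kc_pos : forall w : n.-tuple S, admissible_word P w -> (1 <= kc w)%N.
Hypothesis M0 : (0 < M)%N.
Hypotheses (p0 : (0 < p)%N) (pn : (p %| n)%N) (xp : shiftn p x = x).

Local Notation phi := (ceil_of kc).
Local Notation A := (cyl (mkseq x (n + M))).
Local Notation flow_mass t := ((mu \x lebesgue_measure)%E (@survivors R S a0 phi A t)).

(** A point of the fibre over [y] meets the base up to ceiling sum [s + t < Kmax kc + N.+1], within
    the range of [hit_free]. *)
Lemma section_full (y : nat -> S) (t : R) N : in_SigmaP P y -> 0 <= t -> t < N.+1%:R ->
  hit_free kc x M (N.+1 + Kmax kc) y ->
  xsection (@survivors R S a0 phi A t) y = `[0, (phi y)%:R[%classic.
Proof.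
move=> yS t0 tN hf; apply/seteqP; split=> s /=.
  by rewrite xsectionP in_itv /= => /(survivors_section a0 x M n0 kc_pos _ yS t0)[-> ->].
rewrite in_itv /= xsectionP => /andP[s0 sphi].
apply/(survivors_section a0 x M n0 kc_pos _ yS t0); split=> // i Si; apply: hf.
have : (Sn phi y i)%:R < (Kmax kc + N.+1)%:R :> R.
  apply: le_lt_trans Si _; rewrite natrD ltrD //; apply: lt_trans sphi _.
  by rewrite ltr_nat; exact: kc_lt_Kmax.
by rewrite ltr_nat addnC => /ltnW.
Qed.

Lemma lebesgue_phi (y : nat -> S) :
  lebesgue_measure (`[0%R, (phi y)%:R[%classic : set R) = ((phi y)%:R)%:E.
Proof.
rewrite lebesgue_measure_itv /= lte_fin ltr0n; case: (phi y) => [|m] //=.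
by rewrite oppr0 adde0.
Qed.

Lemma flow_mass_lower (t : R) N : 0 <= t -> t < N.+1%:R ->
  ((mass mu (no_run kc x M (N.+1 + Kmax kc + M * Kmax kc)))%:E <= flow_mass t)%E.
Proof.
move=> t0 tN; set B := no_run _ _ _ _.
have mB : measurable (B : set (Tspace S a0)) by exact: measurable_no_run.
rewrite -(massE pi_stat markov mB) -(mu_setI_Sigma mB).
have mS : measurable ([set y | in_SigmaP P y] : set (Tspace S a0)).
  by rewrite -[X in measurable X]setCK; exact: measurableC measurable_notSigma.
have mBS : measurable (B `&` [set y | in_SigmaP P y] : set (Tspace S a0)) by exact: measurableI.
rewrite -[X in mu X]setIT -(integral_indic mu measurableT mBS) /product_measure1.
apply: le_integralT => y; first by rewrite lee_fin.
rewrite indicE; case: (boolP (y \in _)) => [|_]; last exact: measure_ge0.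
rewrite inE => -[By yS] /=.
rewrite (section_full yS t0 tN) ?lebesgue_phi.
  rewrite lee_fin ler1n -Sn1; apply: leq_ltn_trans (leq0n _) _.
  exact: (Sn_lt a0 n0 kc_pos yS (ltn0Sn 0)).
exact: (no_run_hit_free a0 n0 kc_pos M0 p0 pn xp yS).
Qed.

(** One surviving height excludes visits with ceiling sum at most [N], which puts [y] in [no_run].
    The section is an interval, hence measurable. *)
Lemma section_upper (y : nat -> S) (t : R) N : in_SigmaP P y -> 0 <= t ->
  N%:R <= t -> (Kmax kc <= N)%N ->
  (lebesgue_measure (xsection (@survivors R S a0 phi A t) y)
    <= ((Kmax kc)%:R * \1_(no_run kc x M (N - Kmax kc)) y : R)%:E)%E.
Proof.
move=> yS t0 Nt KN.
have [->|/set0P[s0 hs0]] := eqVneq (xsection (@survivors R S a0 phi A t) y) set0.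
  by rewrite measure0 lee_fin mulr_ge0.
have yB : no_run kc x M (N - Kmax kc) y.
  apply: (hit_free_no_run a0); rewrite subnK // => i iN.
  move: hs0; rewrite xsectionP => /(survivors_section a0 x M n0 kc_pos _ yS t0)[s00 _ h].
  by apply: h; apply: le_trans (_ : N%:R <= _); rewrite ?ler_nat // (le_trans Nt) // lerDr.
rewrite indicE mem_set // mulr1.
apply: (@le_trans _ _ (lebesgue_measure (`[0%R, (phi y)%:R[%classic : set R))); last first.
  by rewrite lebesgue_phi lee_fin ler_nat ltnW // kc_lt_Kmax.
apply: le_measure; rewrite ?inE; last first.
- move=> s; rewrite xsectionP => /(survivors_section a0 x M n0 kc_pos _ yS t0)[h1 h2 _].
  by rewrite /= in_itv /= h1 h2.
- exact: measurable_itv.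
- apply: is_interval_measurable => a b; rewrite !xsectionP.
  move=> /(survivors_section a0 x M n0 kc_pos _ yS t0)[a1 _ _].
  move=> /(survivors_section a0 x M n0 kc_pos _ yS t0)[_ b2 b3] c /andP[ac cb].
  apply/xsectionP/(survivors_section a0 x M n0 kc_pos _ yS t0); split.
  + exact: le_trans ac.
  + exact: le_lt_trans cb b2.
  + by move=> i ic; apply: b3; apply: le_trans ic _; rewrite lerD2r.
Qed.

Lemma flow_mass_upper (t : R) N : 0 <= t -> N%:R <= t -> (Kmax kc <= N)%N ->
  (flow_mass t <= ((Kmax kc)%:R * mass mu (no_run kc x M (N - Kmax kc)))%:E)%E.
Proof.
move=> t0 Nt KN; set B := no_run _ _ _ _.
have mB : measurable (B : set (Tspace S a0)) by exact: measurable_no_run.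
pose Z : set (Tspace S a0) := ~` [set y | in_SigmaP P y].
have mZ : measurable Z by exact: measurable_notSigma.
have mind (C : set (Tspace S a0)) (k : \bar R) : measurable C ->
    measurable_fun setT (fun y => k * (\1_C y : R)%:E)%E.
  by move=> mC; apply: measurable_funeM; apply/measurable_EFinP; exact: measurable_indic.
have iE (C : set (Tspace S a0)) (k : \bar R) : measurable C -> (0 <= k)%E ->
    (\int[mu]_y (k * (\1_C y : R)%:E) = k * mu C)%E.
  move=> mC k0; rewrite ge0_integralZl //.
  - by rewrite integral_indic // setIT.
  - by apply/measurable_EFinP; exact: measurable_indic.
(* Off [Sigma_P] the section is not controlled; it is bounded by infinity on a null set. *)
apply: (@le_trans _ _ (\int[mu]_y (((Kmax kc)%:R : R)%:E * (\1_B y : R)%:E + +oo * (\1_Z y : R)%:E))%E).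
  rewrite /product_measure1; apply: le_integralT => y; first exact: measure_ge0.
  have [yS|yS] := pselect (in_SigmaP P y).
    rewrite [\1_Z y]indicE memNset ?mule0 ?adde0; last by move=> /(_ yS).
    rewrite -EFinM; exact: section_upper.
  rewrite [\1_Z y]indicE mem_set // mule1 addey ?leey //.
have pos (C : set (Tspace S a0)) (k : \bar R) y : (0 <= k)%E -> (0 <= k * (\1_C y : R)%:E)%E.
  by move=> k0; rewrite mule_ge0 // lee_fin.
have K0 : (0 <= ((Kmax kc)%:R : R)%:E)%E by rewrite lee_fin.
have I0 : (0 <= +oo :> \bar R)%E by rewrite leey.
rewrite (@ge0_integralD _ _ _ mu _ measurableT _ _ (fun y _ => pos B _ y K0) (mind B _ mB)
  (fun y _ => pos Z _ y I0) (mind Z _ mZ)).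
by rewrite !iE // mu_notSigma mule0 adde0 (massE pi_stat markov mB).
Qed.

(** Taking logarithms, [- ln (f t) / t] differs from [ln z] by a bounded quantity over [t]; rounding
    [t] down to [N] costs at most [ln z]. *)
Lemma escape_rate_limit (f : R -> R) (z c C : R) t0 : 1 <= z -> 0 < c -> 0 < C -> 0 < t0 ->
  (forall t N, t0 <= t -> N%:R <= t -> t < N.+1%:R -> c <= z ^+ N * f t <= C) ->
  lim ((fun t : R => - ln (f t) / t) @ +oo) = ln z.
Proof.
move=> z1 c0 C0 t00 H; apply: cvg_lim; first exact: norm_hausdorff.
have z0 : 0 < z := lt_le_trans ltr01 z1.
apply/cvgrPdist_le => e e0.
pose L := `|ln c| + `|ln C|.
have L0 : 0 <= L by rewrite addr_ge0.
have lz0 : 0 <= ln z by exact: ln_ge0.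
near=> t.
have tt0 : t0 <= t by near: t; apply: nbhs_pinfty_ge; exact: num_real.
have tp : 0 < t by apply: lt_le_trans tt0.
have te : (ln z + L) / e <= t by near: t; apply: nbhs_pinfty_ge; exact: num_real.
have /andP[Nt tN] := truncn_itv (ltW tp); set N := Num.truncn t in Nt tN.
have /andP[lo hi] := H t N tt0 Nt tN.
have zN : 0 < z ^+ N by rewrite exprn_gt0.
have ft : 0 < f t by rewrite -(pmulr_rgt0 _ zN); exact: lt_le_trans lo.
set l := ln (z ^+ N * f t).
have lE : ln (f t) = l - N%:R * ln z.
  by rewrite /l lnM ?posrE // lnXn // mulr_natl; ring.
have lL : `|l| <= L.
  have h1 : ln c <= l by rewrite ler_ln ?posrE // mulr_gt0.
  have h2 : l <= ln C by rewrite ler_ln ?posrE // mulr_gt0.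
  have := ler_norm (ln C); have := ler_norm (- ln c); rewrite normrN => h3 h4.
  have := normr_ge0 (ln c); have := normr_ge0 (ln C).
  by rewrite ler_norml /L => h5 h6; apply/andP; split; lra.
rewrite lE (_ : ln z - _ = ((t - N%:R) * ln z + l) / t); last by field; rewrite gt_eqF.
rewrite normrM normfV (gtr0_norm tp) ler_pdivrMr //.
apply: le_trans (ler_normD _ _) _; rewrite normrM (ger0_norm lz0).
have d1 : `|t - N%:R| <= 1.
  rewrite ger0_norm ?subr_ge0 //; rewrite -natr1 in tN; lra.
have {}te : ln z + L <= e * t by rewrite mulrC -ler_pdivrMr.
apply: le_trans te; apply: lerD => //.
by rewrite ler_piMl.
Unshelve. all: by end_near.
Qed.

Lemma escape_rateE (z c1 c2 : R) : 1 <= z -> 0 < c1 -> 0 < c2 ->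
  (forall t, c1 <= z ^+ t * mass mu (no_run kc x M t) <= c2) ->
  expR (escape_rate mu phi A) = z.
Proof.
move=> z1 c10 c20 H.
have z0 : 0 < z := lt_le_trans ltr01 z1.
set K := Kmax kc.
have K0 : (0 < K)%N by [].
suff -> : escape_rate mu phi A = ln z by rewrite lnK.
(* Total time shift between [N] and the index in [flow_mass_lower]. *)
pose B := (1 + K + M * K)%N.
apply: (@escape_rate_limit _ z (c1 / z ^+ B) (K%:R * (z ^+ K * c2)) K%:R) => //.
- by rewrite divr_gt0 ?exprn_gt0.
- by rewrite !mulr_gt0 ?exprn_gt0 ?ltr0n.
move=> t N Kt Nt tN.
have t0 : 0 <= t by apply: le_trans Kt.
have KN : (K <= N)%N by rewrite -ltnS -(ltr_nat R); exact: le_lt_trans tN.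
have lo := flow_mass_lower t0 tN; have hi := flow_mass_upper t0 Nt KN.
set F := flow_mass t in lo hi *.
have Ffin : F \is a fin_num.
  rewrite ge0_fin_numE; first exact: le_lt_trans hi (ltry _).
  apply: le_trans lo; by rewrite lee_fin mass_ge0.
rewrite -(fineK Ffin) !lee_fin in lo hi.
apply/andP; split.
  rewrite ler_pdivrMr ?exprn_gt0 //.
  have /andP[h _] := H (N.+1 + Kmax kc + M * Kmax kc)%N.
  apply: le_trans h _; apply: le_trans (ler_wpM2l _ lo) _; first by rewrite exprn_ge0 // ltW.
  have -> : (N.+1 + Kmax kc + M * Kmax kc)%N = (N + B)%N by rewrite /B !addnA addn1.
  by rewrite exprD mulrAC.
have /andP[_ h] := H (N - K)%N.
apply: le_trans (_ : z ^+ N * (K%:R * mass mu (no_run kc x M (N - K))) <= _).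
  by apply: ler_wpM2l => //; rewrite exprn_ge0 // ltW.
rewrite -{1}(subnKC KN) exprD.
rewrite [leLHS](_ : _ = K%:R * (z ^+ K * (z ^+ (N - K) * mass mu (no_run kc x M (N - K))))); last by ring.
by apply: ler_wpM2l => //; apply: ler_wpM2l => //; rewrite exprn_ge0 // ltW.
Qed.

End EscapeRate.

(** * The periodic point: masses of its cylinders, and leaving its orbit *)

Section PeriodicPoint.
Variables (R : realType) (S : finType) (a0 : S) (P : S -> S -> R) (pi : S -> R).
Variable mu : {measure set (Tspace S a0) -> \bar R}.
Hypothesis P0 : nonneg_mx P.
Hypothesis P1 : row_stochastic P.
Hypothesis irr : irreducible P.
Hypothesis pi_stat : stationary_prob P pi.
Hypothesis markov : is_markov_measure P pi mu.
Variables (x : nat -> S) (p : nat).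
Hypothesis xSigma : in_SigmaP P x.
Hypotheses (p0 : (0 < p)%N) (xp : shiftn p x = x).
Hypothesis red : reduced_word P (mkseq x p).

Lemma periodicD i : x (i + p)%N = x i.
Proof. exact: (congr1 (fun f => f i) xp). Qed.

Lemma prod_period (f : nat -> R) a : (forall i, 0 < f i) -> (forall i, f (i + p)%N = f i) ->
  \prod_(i < p) f (a + i)%N = \prod_(i < p) f i.
Proof.
move=> f0 fp; elim: a => [|a <-]; first by apply: eq_bigr.
have fa : f a != 0 by rewrite gt_eqF.
apply: (mulfI fa).
transitivity (\prod_(i < p.+1) f (a + i)%N).
  by rewrite big_ord_recl addn0; congr (_ * _); apply: eq_bigr => i _; rewrite addSnnS.
by rewrite big_ord_recr /= fp mulrC.
Qed.

Lemma c_oE a : \prod_(i < p) P (x (a + i)%N) (x (a + i).+1) = c_o P x p.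
Proof.
apply: (@prod_period (fun i => P (x i) (x i.+1))) => i; first exact: xSigma.
by rewrite -addSn !periodicD.
Qed.

Lemma c_o_gt0 : 0 < c_o P x p.
Proof. by rewrite prodr_gt0 // => i _; exact: xSigma. Qed.

Lemma mass_mkseqD m j : (0 < m)%N ->
  mass mu (cyl (mkseq x (m + j * p))) = mass mu (cyl (mkseq x m)) * c_o P x p ^+ j.
Proof.
move=> m0; have step l : (0 < l)%N ->
    mass mu (cyl (mkseq x l.+1)) = mass mu (cyl (mkseq x l)) * P (x l.-1) (x l).
  move=> l0; rewrite /mkseq -addn1 iotaD map_cat /= add0n cats1.
  rewrite (mass_cyl_rcons markov) ?size_map ?size_iota //.
  by rewrite -nth_last size_map size_iota (nth_map 0%N) ?size_iota ?prednK // nth_iota ?prednK.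
have steps l i : (0 < l)%N ->
    mass mu (cyl (mkseq x (l + i))) = mass mu (cyl (mkseq x l)) * \prod_(h < i) P (x (l.-1 + h)%N) (x (l.-1 + h).+1).
  move=> l0; elim: i => [|i IH]; first by rewrite big_ord0 mulr1 addn0.
  rewrite addnS step ?addn_gt0 ?l0 // IH big_ord_recr mulrA /=.
  by congr (_ * P (x _) (x _)); lia.
elim: j => [|j IH]; first by rewrite mul0n addn0 expr0 mulr1.
by rewrite mulSnr addnA steps ?addn_gt0 ?m0 // c_oE IH exprSr mulrA.
Qed.

Lemma mass_mkseq_gt0 m : (0 < m)%N -> 0 < mass mu (cyl (mkseq x m)).
Proof.
move=> m0; apply: (mass_cyl_gt0 pi_stat markov); first by rewrite size_mkseq.
rewrite admissible_wordE; apply/(sortedP a0) => i; rewrite size_mkseq => im.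
by rewrite !nth_mkseq ?(ltnW im) //; exact: xSigma.
Qed.

(* A reduced periodic word can be left at its last letter; for [p = 1] this uses irreducibility. *)
Lemma deviation : exists2 a, a != x p.-1 & 0 < P (x (p + p - 2)%N) a.
Proof.
have [_ [a' [ne adm]]] := red.
have pp : (p.-1 < p)%N by rewrite ltn_predL.
have a'x : a' != x p.-1 by move: ne; rewrite size_mkseq nth_mkseq.
move: adm; rewrite size_mkseq admissible_wordE => adm.
have [p1|p2] := leqP p 1.
  have pE : p = 1%N by apply/eqP; rewrite eqn_leq p1.
  have [m /(Ppow_path P0)[e he]] := irr (x 0) a'.
  rewrite pE /= in a'x *.
  have [//|none] := pselect (exists2 a, a != x 0%N & 0 < P (x 0%N) a).
  have : last (x 0%N) (rcons e a') = x 0%N.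
    elim: (rcons e a') he => //= b s IH /andP[pb].
    have -> : b = x 0%N by apply/eqP/negP => /negP bx; apply: none; exists b.
    exact: IH.
  by rewrite last_rcons => h; rewrite h eqxx in a'x.
exists a' => //.
have -> : x (p + p - 2)%N = x p.-2.
  by rewrite -[RHS]periodicD; congr x; lia.
move: adm => /(sortedP a0) /(_ p.-2).
have sz : size (take p.-1 (mkseq x p)) = p.-1 by rewrite size_take size_mkseq pp.
have p2' : p.-2.+1 = p.-1 by lia.
rewrite size_rcons sz p2' ltnSn => /(_ isT).
rewrite !nth_rcons sz p2' ltnn eqxx leqnn nth_take ?p2' // nth_mkseq //.
by rewrite p2' ltnW.
Qed.

Lemma P_le1 a b : P a b <= 1.
Proof. by rewrite -(P1 a) (bigD1 b) //= lerDl sumr_ge0. Qed.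

Lemma c_o_lt1 : c_o P x p < 1.
Proof.
have [a ax Pa] := deviation.
(* Rotate the product so that it starts with the transition into [x p.-1], where [deviation] offers
   another letter. The index is [p - 2] modulo [p], free of truncation when [p = 1]. *)
rewrite -(c_oE (p + p - 2)).
have -> : \prod_(i < p) P (x (p + p - 2 + i)%N) (x (p + p - 2 + i).+1)
    = P (x (p + p - 2)%N) (x p.-1) * \prod_(i < p.-1) P (x (p + p - 2 + i.+1)%N) (x (p + p - 2 + i.+1).+1).
  case: p p0 xp => // p' _ xp'; rewrite big_ord_recl /= addn0; congr (_ * _).
  by rewrite -[in RHS](congr1 (fun f => f p') xp') /shiftn; congr (P _ (x _)); lia.
have le1 : 0 <= \prod_(i < p.-1) P (x (p + p - 2 + i.+1)%N) (x (p + p - 2 + i.+1).+1) <= 1.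
  elim/big_ind: _ => [|u v /andP[u0 u1] /andP[v0 v1]|i _]; first by rewrite ler01 lexx.
    by rewrite mulr_ge0 //= mulr_ile1.
  by rewrite P0 P_le1.
have /andP[l0 l1] := le1.
apply: (@le_lt_trans _ _ (P (x (p + p - 2)%N) (x p.-1))); first by rewrite ler_piMr.
rewrite -(P1 (x (p + p - 2)%N)) (bigD1 (x p.-1)) //= ltrDl.
rewrite (bigD1 a) //=; apply: ltr_pwDl => //.
by apply: sumr_ge0 => b _; exact: P0.
Qed.

End PeriodicPoint.

(** * The offsets along a run *)

Section RunOffsets.
Variables (R : realType) (S : finType) (a0 : S) (P : S -> S -> R).
Hypothesis P0 : nonneg_mx P.
Hypothesis P1 : row_stochastic P.
Hypothesis irr : irreducible P.
Variables (x : nat -> S) (p n s : nat) (kc : n.-tuple S -> nat).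
Hypothesis xSigma : in_SigmaP P x.
Hypotheses (p0 : (0 < p)%N) (xp : shiftn p x = x).
Hypothesis prime_period : forall q, (0 < q < p)%N -> shiftn q x <> x.
Hypothesis red : reduced_word P (mkseq x p).
Hypotheses (n0 : (0 < n)%N) (pn : (p %| n)%N) (s0 : (0 < s)%N).

Local Notation wnd := (@wnd S n).
Local Notation tau := (wnd x 0).
Let M := (s * p)%N.

Variables z D : R.
Let c := c_o P x p * z ^+ o_per x p kc.

Definition wnd_weight l : R := z ^+ kc (wnd x l) * P (x (l + n).-1) (x (l + n)%N).

(** Solves the offset recursion backwards from the end of the run, [r] being the number of letters
    left. The end value [-1] cancels [K tau = 1]. *)
Fixpoint back_offset r : R :=
  if r is r'.+1 then wnd_weight (M - r'.+1) * back_offset r' - D *+ (wnd x (M - r'.+1) == tau)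
  else -1.

Lemma wnd_periodic l k : wnd x (l + k * p) = wnd x l.
Proof.
apply/(wnd_eqP a0) => j jn.
by rewrite addnAC (periodic_add xp).
Qed.

Lemma wnd_weight_periodic l k : wnd_weight (l + k * p) = wnd_weight l.
Proof.
rewrite /wnd_weight wnd_periodic; congr (_ * P _ _).
  by rewrite -[RHS](periodic_add xp k); congr x; lia.
by rewrite addnAC (periodic_add xp).
Qed.

(** Minimality of the period: the defect [D] enters exactly once per period. *)
Lemma wnd_eq_tau l : (wnd x l == tau) = (p %| l)%N.
Proof.
apply/eqP/idP => [h|/dvdnP[k ->]]; last by rewrite -[(k * p)%N]add0n wnd_periodic.
have xl := wnd_tau_shift a0 p0 pn n0 xp h.
have xq : shiftn (l %% p) x = x.
  apply/funext => j; rewrite /shiftn -[in RHS]xl -[LHS](periodic_add xp (l %/ p)).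
  by congr x; rewrite [in RHS](divn_eq l p); lia.
have [/eqP|q0] := posnP (l %% p)%N; first by [].
by have := prime_period _ xq; rewrite q0 ltn_mod p0; case.
Qed.

Lemma prod_wnd_weight : \prod_(i < p) wnd_weight i = c.
Proof.
rewrite /wnd_weight big_split /= mulrC /c; congr (_ * _).
  rewrite -(c_oE xSigma xp n.-1); apply: eq_bigr => i _.
  by congr (P (x _) (x _)); lia.
rewrite /o_per /Sn; elim: p => [|q IH]; first by rewrite !big_ord0 expr0.
by rewrite !big_ord_recr /= IH exprD.
Qed.

Lemma back_offset_partial j r : (j < s)%N -> (r < p)%N ->
  back_offset (j * p + r) = (\prod_(i < r) wnd_weight (p - r + i)) * back_offset (j * p).
Proof.
move=> js; elim: r => [|r IH] rp; first by rewrite big_ord0 mul1r addn0.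
rewrite addnS /= IH ?(ltnW rp) //.
have -> : (M - (j * p + r).+1)%N = (p - r.+1 + (s - j.+1) * p)%N.
  have h : (s * p = (s - j.+1) * p + j * p + p)%N.
    by rewrite -{1}(subnK js) mulnDl mulSnr addnA.
  rewrite /M h; move: ((s - j.+1) * p)%N (j * p)%N => u v; lia.
rewrite wnd_periodic wnd_weight_periodic wnd_eq_tau.
have -> : (p %| p - r.+1)%N = false.
  by apply/negP => /dvdn_leq; rewrite subn_gt0 rp => /(_ isT); lia.
rewrite subr0 big_ord_recl addn0 -mulrA; congr (_ * (_ * _)).
by apply: eq_bigr => i _; congr wnd_weight; rewrite /= /bump; lia.
Qed.

Lemma back_offset_period j : (j < s)%N ->
  back_offset (j.+1 * p) = c * back_offset (j * p) - D.
Proof.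
move=> js; have := @back_offset_partial j p.-1 js; rewrite prednK // leqnn => /(_ isT) E.
have -> : (j.+1 * p = (j * p + p.-1).+1)%N by rewrite mulSn; lia.
rewrite /= E.
have -> : (M - (j * p + p.-1).+1)%N = (0 + (s - j.+1) * p)%N.
  have h : (s * p = (s - j.+1) * p + j * p + p)%N.
    by rewrite -{1}(subnK js) mulnDl mulSnr addnA.
  rewrite /M h; move: ((s - j.+1) * p)%N (j * p)%N => u v; lia.
rewrite wnd_periodic wnd_weight_periodic eqxx mulrA; congr (_ * _ - _).
rewrite -prod_wnd_weight.
transitivity (\prod_(i < p.-1.+1) wnd_weight i); last by rewrite prednK.
rewrite big_ord_recl; congr (_ * _); apply: eq_bigr => i _; congr wnd_weight.
by rewrite /= /bump; lia.
Qed.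

(** Sum of the geometric recursion of [back_offset_period], multiplied by [1 - c]. *)
Lemma back_offset_closed j : (j <= s)%N ->
  (1 - c) * back_offset (j * p) = - c ^+ j * (1 - c) - D * (1 - c ^+ j).
Proof.
elim: j => [|j IH] js; first by rewrite mul0n expr0 /=; ring.
rewrite back_offset_period // mulrBr mulrCA IH ?(ltnW js) // exprS; ring.
Qed.

Definition run_offset l : R := back_offset (M - l).

Lemma run_offset0 : 1 - c != 0 -> c ^+ s * (1 - c) + D * (1 - c ^+ s) = 0 ->
  run_offset 0 = 0.
Proof.
move=> c1 D_root; rewrite /run_offset subn0; apply: (mulfI c1); rewrite mulr0 back_offset_closed //.
by rewrite -[RHS]oppr0 -D_root; ring.
Qed.

Lemma run_offset_rec l : (l < M)%N ->
  run_offset l = wnd_weight l * run_offset l.+1 - D *+ (wnd x l == tau).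
Proof.
move=> lM; rewrite /run_offset.
have -> : (M - l = (M - l.+1).+1)%N by lia.
by rewrite /= (_ : (M - (M - l.+1).+1)%N = l) //; lia.
Qed.

Variable K : n.-tuple S -> R.
Hypothesis K_tau : K tau = 1.

Lemma run_offset_dead : K (wnd x M) + run_offset M = 0.
Proof. by rewrite /run_offset subnn /M -[(s * p)%N]add0n wnd_periodic K_tau subrr. Qed.

Hypothesis z0 : 0 < z.
Hypothesis K_pos : forall w : n.-tuple S, admissible_word P w -> 0 < K w.
Hypothesis K_rec : forall w : n.-tuple S, admissible_word P w ->
  K w = z ^+ kc w * (\sum_a P (last a0 w) a * K (next_word w a)) + D *+ (w == tau).

(** The defects cancel in the recursion for [K + d], leaving nonnegative terms only, so positivity
    goes backwards along the run. At the last letter the continuing term is 0, and positivity comes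
    from the letter of [deviation] that leaves the run. *)
Lemma run_offset_live l : (l < M)%N -> 0 < K (wnd x l) + run_offset l.
Proof.
have adm k : admissible_word P (wnd x k).
  by apply: (@admissible_wnd _ _ a0 _ _ n0 x (k + n) k _ (leqnn _)) => i _; exact: xSigma.
have Knext k a : 0 <= P (last a0 (wnd x k)) a * K (next_word (wnd x k) a).
  have := P0 (last a0 (wnd x k)) a; rewrite le_eqVlt => /orP[/eqP <-|pa]; first by rewrite mul0r.
  by rewrite mulr_ge0 ?(ltW pa) // ltW // K_pos //; exact: next_word_admissible pa.
have rec k : (k < M)%N -> K (wnd x k) + run_offset k = z ^+ kc (wnd x k) *
    (P (x (k + n).-1) (x (k + n)%N) * (K (wnd x k.+1) + run_offset k.+1)
     + \sum_(a | a != x (k + n)%N) P (x (k + n).-1) a * K (next_word (wnd x k) a)).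
  move=> kM; rewrite run_offset_rec // K_rec // addrACA -addrA addrA [D *+ _ - _]addrC addrA.
  rewrite (bigD1 (x (k + n)%N)) //= -(wndS a0) // last_wnd // /wnd_weight; ring.
have pos k : (k < M)%N -> ((k.+1 < M)%N -> 0 < K (wnd x k.+1) + run_offset k.+1) ->
    0 < K (wnd x k) + run_offset k.
  move=> kM IH; rewrite rec // mulr_gt0 ?exprn_gt0 //.
  have sum0 : 0 <= \sum_(a | a != x (k + n)%N) P (x (k + n).-1) a * K (next_word (wnd x k) a).
    by apply: sumr_ge0 => a _; have := Knext k a; rewrite last_wnd.
  have [k1M|Mk1] := ltnP k.+1 M.
    rewrite ltr_pwDl // mulr_gt0 ?IH //.
    by have := xSigma (k + n).-1; rewrite prednK // addn_gt0 n0 orbT.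
  have -> : k.+1 = M by apply/eqP; rewrite eqn_leq kM.
  rewrite run_offset_dead mulr0 add0r.
  have kE : k = M.-1 by lia.
  have [a ax Pa] := deviation a0 P0 irr p0 xp red.
  have /dvdnP[r nr] := pn.
  have r0 : (0 < r)%N by rewrite lt0n; apply/eqP => r0; move: n0; rewrite nr r0 mul0n.
  have e1 : x (k + n)%N = x p.-1.
    rewrite -[RHS](periodic_add xp (s + r - 1)); congr x; rewrite kE /M nr mulnBl mulnDl mul1n.
    have : (0 < s * p)%N by rewrite muln_gt0 s0.
    have : (p <= r * p)%N by rewrite leq_pmull.
    by lia.
  have e2 : x (k + n).-1 = x (p + p - 2)%N.
    rewrite -[RHS](periodic_add xp (s + r - 2)); congr x; rewrite kE /M nr mulnBl mulnDl.
    have : (p <= r * p)%N by rewrite leq_pmull.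
    have : (p <= s * p)%N by rewrite leq_pmull.
    by lia.
  rewrite (bigD1 a) /=; last by rewrite e1.
  apply: ltr_pwDl.
    rewrite e2 mulr_gt0 // K_pos //; apply: (next_word_admissible (a0 := a0)) => //.
    by rewrite last_wnd // e2.
  by apply: sumr_ge0 => b _; have := Knext k b; rewrite last_wnd.
move=> lM; have [m ml] := ubnP (M - l)%N.
elim: m l lM ml => // m IH l lM ml; apply: pos => // l1M; apply: IH => //; lia.
Qed.

End RunOffsets.

(** With [lam = - ln c], [expR (lam s) >= (b s)^(K+1)] for [b = lam/(K+1)], so [s^(K+1) c^s] is
    bounded and the spare factor [s] beats the constant [Q]. *)
Lemma exprn_geometric_le (R : realType) (c m eta : R) (o K : nat) :
  0 < c -> c < 1 -> 0 <= m -> 0 < eta ->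
  exists N, forall s, (N <= s)%N -> (s * o).+1%:R ^+ K * (m * c ^+ s) <= eta.
Proof.
move=> c0 c1 m0 eta0; pose lam := - ln c.
have lam0 : 0 < lam by rewrite oppr_gt0 ln_lt0 // c0.
pose b := lam / K.+1%:R.
have b0 : 0 < b by rewrite divr_gt0.
pose a := b ^+ K.+1.
have a0 : 0 < a by rewrite exprn_gt0.
pose Q := o.+1%:R ^+ K * m / (c * a * eta).
have Q0 : 0 <= Q.
  by apply: divr_ge0; [rewrite mulr_ge0 ?exprn_ge0|rewrite !mulr_ge0 // ltW].
exists (Num.truncn Q) => s Ns.
have Qs : Q <= s.+1%:R.
  have /andP[_ h] := truncn_itv Q0; apply: le_trans (ltW h) _.
  by rewrite ler_nat ltnS.
have cexp : c ^+ s.+1 * expR (lam * s.+1%:R) = 1.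
  by rewrite expRM_natr -exprMn expRN lnK ?posrE // mulfV ?expr1n // gt_eqF.
have h1 : a * s.+1%:R ^+ K.+1 <= expR (lam * s.+1%:R).
  rewrite -exprMn (_ : lam * _ = (b * s.+1%:R) * K.+1%:R); last first.
    by rewrite /b mulrAC divfK // pnatr_eq0.
  rewrite expRM_natr lerXn2r ?nnegrE ?expR_ge0 ?mulr_ge0 ?(ltW b0) ?(ltW lam0) //.
  by apply: le_trans (expR_ge1Dx _); rewrite lerDr.
have h2 : a * s.+1%:R ^+ K.+1 * c ^+ s.+1 <= 1.
  by rewrite -[leRHS]cexp mulrC ler_wpM2l // exprn_ge0 // ltW.
have s0 : 0 < s.+1%:R :> R by rewrite ltr0n.
have h3 : (s * o).+1%:R ^+ K <= o.+1%:R ^+ K * s.+1%:R ^+ K :> R.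
  rewrite -exprMn lerXn2r ?nnegrE ?mulr_ge0 // -natrM ler_nat.
  rewrite mulSn mulnS mulnC addSn ltnS; exact: leq_trans (leq_addl o _) (leq_addl s _).
apply: le_trans (_ : o.+1%:R ^+ K * s.+1%:R ^+ K * (m * c ^+ s) <= _).
  by rewrite ler_wpM2r // mulr_ge0 ?exprn_ge0 // ltW.
have ca0 : 0 < c * a * s.+1%:R by rewrite !mulr_gt0.
rewrite -(ler_pM2l ca0).
rewrite [leLHS](_ : _ = o.+1%:R ^+ K * m * (a * s.+1%:R ^+ K.+1 * c ^+ s.+1)); last first.
  by rewrite !exprS; ring.
apply: le_trans (_ : o.+1%:R ^+ K * m <= _).
  by rewrite ler_piMr // mulr_ge0 ?exprn_ge0.
move: Qs; rewrite /Q ler_pdivrMr ?mulr_gt0 // => h; apply: le_trans h _.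
by rewrite le_eqVlt; apply/orP; left; apply/eqP; ring.
Qed.

(** * The Taylor conditions as vanishing coefficients of the residual *)

Section TaylorResidual.
Variables (R : realType) (S : finType) (a0 : S) (P : S -> S -> R) (pi : S -> R).
Variable mu : {measure set (Tspace S a0) -> \bar R}.
Hypothesis markov : is_markov_measure P pi mu.
Variables (x : nat -> S) (p n : nat) (kc : n.-tuple S -> nat) (k : nat).
Hypothesis xSigma : in_SigmaP P x.
Hypotheses (p0 : (0 < p)%N) (xp : shiftn p x = x).
Hypotheses (n0 : (0 < n)%N) (pn : (p %| n)%N).
Hypothesis kc_pos : forall w : n.-tuple S, admissible_word P w -> (1 <= kc w)%N.
Hypothesis co1 : c_o P x p < 1.
Hypotheses (mw0 : 0 < mu_w mu x p) (mt0 : 0 < mu_t mu x n).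

Local Notation tau := (wnd n x 0).
Local Notation q := (adj_col P kc tau tau).
Local Notation G := (Gpoly P kc).
Local Notation co := (c_o P x p).
Local Notation o := (o_per x p kc).

(** With [rhs_poly], the pair [A], [B] to which [implicit_root_expansion] is applied, in the
    variable [y = z - 1]. *)
Definition det_poly : {poly R} := G \Po ('X + 1).
Definition rhs_poly : {poly R} :=
  ((mu_t mu x n)^-1 *: (q * (1 - co%:P * 'X^o) + ('X - 1) * G)) \Po ('X + 1).

Lemma horner_det_poly y : det_poly.[y] = G.[1 + y].
Proof. by rewrite /det_poly horner_comp !hornerE addrC. Qed.

Lemma horner_rhs_poly y : rhs_poly.[y] =
  (mu_t mu x n)^-1 * (q.[1 + y] * (1 - co * (1 + y) ^+ o) + y * G.[1 + y]).
Proof.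
rewrite /rhs_poly horner_comp !hornerE [y + 1]addrC.
by rewrite (_ : 1 + y - 1 = y); last by ring.
Qed.

Definition shift_poly (sv : nat -> R) : {poly R} :=
  \poly_(j < k.+1) (if j == 0%N then 0 else sv j).

Lemma zpolyE sv u : zpoly k sv u = 1 + (shift_poly sv).[u].
Proof.
rewrite /zpoly horner_poly big_ord_recl mul0r add0r big_add1 big_mkord.
by congr (_ + _); apply: eq_bigr => i _.
Qed.

Lemma wt_wnd : wt x n = tau.
Proof. by rewrite /wt /wnd shiftn0. Qed.

(** As [p] divides [n], row and column index agree, so the cofactor in [g2] is [q_tau]. *)
Lemma wr_wnd nu : (n %/ p < nu)%N -> wr x p n nu = tau.
Proof.
move=> nnu; apply/eq_from_tnth => i; rewrite !tnth_mktuple /shiftn addn0.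
have -> : (nu * p - n + i = i + (nu - n %/ p) * p)%N.
  by rewrite mulnBl divnK // addnC.
exact: periodic_add.
Qed.

Lemma c_o_mu_w : co ^ (1 - (n %/ p)%:Z) / mu_w mu x p = (mu_t mu x n)^-1.
Proof.
have co0 : 0 < co by exact: c_o_gt0.
have r0 : (0 < n %/ p)%N by rewrite divn_gt0 // dvdn_leq.
have -> : mu_t mu x n = mu_w mu x p * co ^+ (n %/ p).-1.
  have := mass_mkseqD markov xSigma p0 xp (n %/ p).-1 p0.
  rewrite (_ : (p + _ * p)%N = n) //.
  by rewrite -mulSn prednK // divnK.
have -> : 1 - (n %/ p)%:Z = - ((n %/ p).-1)%:Z by rewrite -{1}(prednK r0); lia.
by rewrite -exprz_inv exprnP -exprnP exprVn invfM mulrC.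
Qed.

(** Over the common denominator [1 - c_o z(u)^o], which is nonzero at [u = 0] as [c_o < 1], the
    numerator of [taylor_fun] is the residual at [u]. Its constant term vanishes because
    [z(0) = 1]. *)
Lemma taylor_residual nu sv : admissible_word P tau -> (n %/ p < nu)%N ->
  s_coeffs_spec P mu x p kc k nu sv -> forall i, (i <= k)%N ->
  (residual det_poly rhs_poly ((nu - n %/ p) * o) (shift_poly sv))`_i = 0.
Proof.
move=> taua nnu spec; set Y := shift_poly sv; set N := residual _ _ _ _.
pose Dn : {poly R} := 1 - co%:P * (1 + Y) ^+ o.
have Y0 : Y.[0] = 0 by rewrite horner_coef0 coef_poly.
have DnE u : Dn.[u] = 1 - co * (1 + Y.[u]) ^+ o by rewrite /Dn !hornerE.
have Dn0 : Dn.[0] != 0.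
  by rewrite DnE Y0 addr0 expr1n mulr1 subr_eq0 gt_eqF.
have NE u : N.[u] = - (Y.[u] * G.[1 + Y.[u]]) + u * ((1 + Y.[u]) ^+ ((nu - n %/ p) * o) *
    ((mu_t mu x n)^-1 * (q.[1 + Y.[u]] * (1 - co * (1 + Y.[u]) ^+ o) + Y.[u] * G.[1 + Y.[u]]))).
  by rewrite /N horner_residual horner_det_poly horner_rhs_poly.
have CE : @Cpoly R S P n kc (wt x n, ord0) (wr x p n nu, ord0) = q.
  by rewrite wt_wnd wr_wnd // adj_col_tau.
have tE u : Dn.[u] != 0 -> taylor_fun P mu x p kc k nu sv u = N.[u] / Dn.[u].
  rewrite DnE NE /taylor_fun /g1 /g2 CE c_o_mu_w zpolyE -/Y => D0.
  by rewrite [(o * _)%N]mulnC; field; rewrite D0 gt_eqF.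
have near : \forall u \near (0 : R), taylor_fun P mu x p kc k nu sv u = N.[u] / Dn.[u].
  by apply: filterS (near_horner_neq0 Dn0) => u; exact: tE.
apply: (derive1n_fraction_eq0 Dn0); first by rewrite NE Y0 !mul0r oppr0 addr0.
by move=> m mk; rewrite -(nbhs_singleton (near_eq_derive1n m near)) spec.
Qed.

End TaylorResidual.

(** * The expansion of z_nu *)

Lemma closing_equation (R : fieldType) (a c q y g : R) : q != 0 ->
  y * g = a * (q * (1 - c) + y * g) -> a * (1 - c) + (1 - (1 + y)) * g / q * (1 - a) = 0.
Proof.
move=> q0 h; apply: (mulfI q0); rewrite mulr0.
transitivity (a * (q * (1 - c) + y * g) - y * g); first by field.
by rewrite -h subrr.
Qed.

Theorem theorem7p8
  (R : realType) (S : finType) (a0 : S) (P : S -> S -> R) (pi : S -> R)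
  (mu : {measure set (Tspace S a0) -> \bar R}) (beta : R)
  (x : nat -> S) (p n : nat) (kc : n.-tuple S -> nat) (k : nat)
  (s : nat -> nat -> R) :
  nonneg_mx P -> row_stochastic P -> irreducible P ->
  stationary_prob P pi -> is_markov_measure P pi mu ->
  0 < beta ->
  (* x in Sigma_P is periodic of prime (= minimal) period p *)
  in_SigmaP P x -> (0 < p)%N -> shiftn p x = x ->
  (forall q : nat, (0 < q < p)%N -> shiftn q x <> x) ->
  (* (x_1,...,x_p) is reduced *)
  reduced_word P (mkseq x p) ->
  (* the local escape rate rho(x, 1) exists *)
  local_escape_rate_exists P mu beta x ->
  (* phi = sum_C k_C 1_C, N-valued, constant on n-cylinders, inf phi > 0,
     n a positive multiple of p *)
  (0 < n)%N -> (p %| n)%N ->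
  (forall w : n.-tuple S, admissible_word P w -> (1 <= kc w)%N) ->
  (* s_1(nu),...,s_k(nu) as in the context, for nu > n/p *)
  (forall nu : nat, (n %/ p < nu)%N -> s_coeffs_spec P mu x p kc k nu (s nu)) ->
  let A := fun nu : nat => cyl (mkseq x (nu * p)) in
  let mu_nu := fun nu : nat => fine (mu (A nu)) in
  let z_nu := fun nu : nat => expR (escape_rate mu (ceil_of kc) (A nu)) in
  forall eps : R, 0 < eps ->
    \forall nu \near \oo,
      `| z_nu nu - (1 + \sum_(1 <= j < k.+1) s nu j * mu_nu nu ^+ j) |
        <= eps * mu_nu nu ^+ k.
Proof.
move=> P0 P1 irr pi_stat markov _ xSigma p0 xp minper red _ n0 pn kc_pos spec A mu_nu z_nu eps eps0.
set tau := wnd n x 0.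
have taua : admissible_word P tau by exact: (wnd_Sigma a0 n0 0 xSigma).
set co := c_o P x p; set o := o_per x p kc; set r := (n %/ p)%N.
have co0 : 0 < co by exact: c_o_gt0.
have co1 : co < 1 by exact: (c_o_lt1 a0 P0 P1 irr xSigma p0 xp red).
have mw0 : 0 < mu_w mu x p by exact: (mass_mkseq_gt0 pi_stat markov xSigma p0).
have mt0 : 0 < mu_t mu x n by exact: (mass_mkseq_gt0 pi_stat markov xSigma n0).
set mt := mu_t mu x n in mt0 *.
set q := adj_col P kc tau; set G := Gpoly P kc.
(* At [y = 0] the product is [G(1) q_tau(1) (1 - c_o) / mu_t]. *)
have AB0 : 0 < (det_poly P kc)`_0 * (rhs_poly P mu x p kc)`_0.
  rewrite -!horner_coef0 horner_det_poly horner_rhs_poly addr0 expr1n mulr1 mul0r addr0.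
  rewrite mulrCA mulr_gt0 ?invr_gt0 // mulrA mulr_gt0 ?subr_gt0 //.
  exact: (Gpoly_adj_col_gt0 a0 P0 P1 irr n0 kc_pos taua).
have [C C0 [dl dl0 root]] := implicit_root_expansion k AB0.
have [d1 d10 near_K] := eigen_ratio_near1 a0 P0 P1 irr n0 kc_pos taua.
have [|d2 d20 near_c] := near1_interval (near_horner_gt0 (p := 1 - co%:P * 'X^o) _).
  by rewrite !hornerE expr1n mulr1 subr_gt0.
(* [dl] serves the root lemma and [eps / C] the final error; [d1 / C] and [d2 / C] keep the root
   [y <= C * m] where [K] is positive and [c_o z^o < 1]. *)
pose eta := Num.min dl (Num.min (eps / C) (Num.min (d1 / C) (d2 / C))).
have eta0 : 0 < eta by rewrite !lt_min dl0 !divr_gt0.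
have [N0 decay] := @exprn_geometric_le R co mt eta o k.+1 co0 co1 (ltW mt0) eta0.
exists (N0 + r).+1 => // nu /= nu_big.
have rnu : (r < nu)%N := leq_ltn_trans (leq_addl N0 r) nu_big.
set s_ := (nu - r)%N; have s0 : (0 < s_)%N by rewrite subn_gt0.
have Ns : (N0 <= s_)%N by rewrite leq_subRL ?(ltnW rnu) // addnC ltnW.
have nuE : (nu * p = n + s_ * p)%N.
  by rewrite /s_ mulnBl [(r * p)%N]divnK // subnKC // -(divnK pn) leq_mul2r (ltnW rnu) orbT.
have mu_nuE : mu_nu nu = mt * co ^+ s_.
  by rewrite /mu_nu /A nuE; exact: (mass_mkseqD markov xSigma p0 xp s_ n0).
set m := mu_nu nu in mu_nuE *.
have m0 : 0 < m by rewrite mu_nuE mulr_gt0 // exprn_gt0.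
set kp := ((s_ * o).+1%:R : R).
have kp1 : 1 <= kp by rewrite ler1n.
have dec : kp ^+ k.+1 * m <= eta by rewrite mu_nuE; exact: decay.
have kpm : kp * m <= eta.
  by apply: le_trans dec; rewrite ler_wpM2r ?(ltW m0) // -[leLHS]expr1 ler_weXn2l.
have meta : m <= eta by apply: le_trans kpm; rewrite ler_peMl // ltW.
have [e1 e2 e3 e4] : [/\ eta <= dl, eta <= eps / C, eta <= d1 / C & eta <= d2 / C].
  by split; rewrite /eta !ge_min lexx ?orbT.
have Y0 : (shift_poly k (s nu))`_0 = 0 by rewrite coef_poly.
have [|y [y0 yC yroot yY]] := root (s_ * o)%N m _ m0 (le_trans kpm e1) Y0 (size_poly _ _).
  exact: (taylor_residual markov xSigma p0 xp n0 pn kc_pos co1 mw0 mt0 taua rnu (spec nu rnu)).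
(* The root is identified with the escape rate by feeding [K] and the offsets at [z = 1 + y] into
   [no_run_mass]. *)
have zy : z_nu nu = 1 + y.
  pose z := 1 + y; pose D := (1 - z) * G.[z] / (q tau).[z].
  have z1 : 1 <= z by rewrite lerDl ltW.
  have yd d : eta <= d / C -> z <= 1 + d.
    move=> ed; rewrite lerD2l; apply: le_trans yC _; rewrite mulrC -ler_pdivlMr //.
    exact: le_trans meta ed.
  have [qz K_pos] := near_K z z1 (yd _ e3).
  have c_ne : 1 - co * z ^+ o != 0.
    by have := near_c z z1 (yd _ e4); rewrite !hornerE => h; rewrite gt_eqF.
  have K_rec (w : n.-tuple S) (wa : admissible_word P w) := eigen_ratio_rec a0 P0 P1 n0 kc_pos taua qz wa.
  have K_tau : eigen_ratio P kc tau z tau = 1 by rewrite /eigen_ratio divff.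
  have D_root : (co * z ^+ o) ^+ s_ * (1 - co * z ^+ o) + D * (1 - (co * z ^+ o) ^+ s_) = 0.
    apply: closing_equation qz _.
    move: yroot; rewrite horner_det_poly horner_rhs_poly mu_nuE -/tau -/q -/G -/mt -/co -/o -/z => h; apply: etrans h _.
    rewrite exprMn -exprM [(o * s_)%N]mulnC; field; exact: lt0r_neq0.
  have M0 : (0 < s_ * p)%N by rewrite muln_gt0 s0.
  have [[c1 c2] [/= c10 c20] bounds] := no_run_mass P0 pi_stat markov n0 kc_pos M0 xSigma z1 K_pos K_rec
    (run_offset0 a0 xSigma p0 xp minper n0 pn s0 c_ne D_root)
    (run_offset_rec P x kc p0 n0 pn s0 z D)
    (run_offset_dead a0 P s_ kc xp z D K_tau)
    (run_offset_live P0 irr xSigma p0 xp red n0 pn s0 K_tau (lt_le_trans ltr01 z1) K_pos K_rec).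
  rewrite /z_nu /A nuE.
  exact: (escape_rateE P0 pi_stat markov n0 kc_pos M0 p0 pn xp z1 c10 c20 bounds).
have -> : z_nu nu - (1 + \sum_(1 <= j < k.+1) s nu j * m ^+ j) = y - (shift_poly k (s nu)).[m].
  by have := zpolyE k (s nu) m; rewrite /zpoly zy => ->; ring.
apply: le_trans yY _; rewrite exprMn [m ^+ k.+1]exprS.
rewrite [leLHS](_ : _ = C * (kp ^+ k.+1 * m) * m ^+ k); last by rewrite /kp; ring.
rewrite ler_wpM2r ?exprn_ge0 ?(ltW m0) //.
rewrite mulrC -ler_pdivlMr //; exact: le_trans dec e2.
Qed.
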